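(* Let $\mathbb K$ be a field, $H$ a Hopf algebra over $\mathbb K$ with invertible antipode, $A$ a right $H$-comodule algebra, and $\gamma:H\otimes H\to\mathbb K$ a 2-cocycle on $H$. Then $A$ is a principal $H$-comodule algebra if and only if $A_\gamma$ is a principal $H_\gamma$-comodule algebra.
   Context: $\otimes=\otimes_{\mathbb K}$; Sweedler notation $\Delta(h)=h_{(1)}\otimes h_{(2)}$, right coactions $\delta(a)=a_{(0)}\otimes a_{(1)}$. A right $H$-comodule algebra is a unital associative algebra $A$ with a right $H$-coaction $\delta^A:A\to A\otimes H$ that is a unital algebra map; $A^{coH}=\{b\in A:\delta^A(b)=b\otimes1_H\}$. A principal $H$-comodule algebra is a right $H$-comodule algebra $A$ such that, with $B:=A^{coH}$: (1) $B\subseteq A$ is $H$-Hopf-Galois, i.e. the canonical map $A\otimes_BA\to A\otimes H$, $a\otimes_Ba'\mapsto aa'_{(0)}\otimes a'_{(1)}$ is bijective; (2) $A$ is equivariantly projective as a left $B$-module, i.e. there exists a left $B$-module and right $H$-comodule morphism $s:A\to B\otimes A$ (left $B$-action by multiplication on the first factor, tensor product coaction, trivial on $B$) with $m\circ s=\mathrm{id}_A$, where $m:B\otimes A\to A$ is the restricted product. A 2-cocycle on $H$ is a convolution invertible $\mathbb K$-linear map $\gamma:H\otimes H\to\mathbb K$ (inverse $\bar\gamma$) with $\gamma(h\otimes1)=\varepsilon(h)=\gamma(1\otimes h)$ and $\gamma(g_{(1)}\otimes h_{(1)})\gamma(g_{(2)}h_{(2)}\otimes k)=\gamma(h_{(1)}\otimes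 k_{(1)})\gamma(g\otimes h_{(2)}k_{(2)})$ for all $g,h,k\in H$. $H_\gamma$ is the Hopf algebra with the coalgebra structure and unit of $H$, product $h\cdot_\gamma k=\gamma(h_{(1)}\otimes k_{(1)})h_{(2)}k_{(2)}\bar\gamma(h_{(3)}\otimes k_{(3)})$ and antipode $S_\gamma=u_\gamma*S*\bar u_\gamma$, where $u_\gamma(h)=\gamma(h_{(1)}\otimes S(h_{(2)}))$ and $\bar u_\gamma(h)=\bar\gamma(S(h_{(1)})\otimes h_{(2)})$. $A_\gamma$ is the right $H_\gamma$-comodule algebra with the module, unit and coaction of $A$ and product $a\bullet_\gamma a'=a_{(0)}a'_{(0)}\bar\gamma(a_{(1)}\otimes a'_{(1)})$. *)

(* Defs.v *)
From HB Require Import structures.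
From mathcomp Require Import all_boot all_order all_algebra.
From mathcomp Require Import boolp.

Set Implicit Arguments.
Unset Strict Implicit.
Unset Printing Implicit Defensive.

Import GRing.Theory.
Local Open Scope ring_scope.
Local Open Scope quotient_scope.

Section BalancedTensor.

Variables (K : fieldType) (U V : lmodType K).
Variables (I : Type) (ra : U -> I -> U) (la : I -> V -> V).

Definition bilinear_map (W : lmodType K) (f : U -> V -> W) : Prop :=
  (forall v, linear (f^~ v)) /\ (forall u, linear (f u)).

Definition balanced (W : lmodType K) (f : U -> V -> W) : Prop :=
  forall u i v, f (ra u i) v = f u (la i v).

(* The list [:: (u_1, v_1); ...; (u_n, v_n)] stands for the formal sum of the
   u_k (x) v_k.  Two formal sums are identified when no balanced bilinear map
   separates them; [tlift_ten] and [ten_ind] below give the universal property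
   of the quotient. *)
Definition formal_eval (W : nmodType) (f : U -> V -> W) (s : seq (U * V)) : W :=
  \sum_(p <- s) f p.1 p.2.

Definition formal_eq (s t : seq (U * V)) : bool :=
  `[< forall (W : lmodType K) (f : U -> V -> W),
        bilinear_map f -> balanced f -> formal_eval f s = formal_eval f t >].

Lemma formal_eq_is_equiv : equiv_class_of formal_eq.
Proof.
split=> [s|s t|t s r].
- exact/asboolP.
- by apply/asboolP/asboolP => h W f hf bf; rewrite h.
- by move=> /asboolP h1 /asboolP h2; apply/asboolP => W f hf bf; rewrite h1 ?h2.
Qed.

Canonical formal_eq_equiv := EquivRelPack formal_eq_is_equiv.

Definition btensor : Type := {eq_quot formal_eq}.

HB.instance Definition _ := Choice.on btensor.

Implicit Types (x y z : btensor).

Lemma formal_piP (s t : seq (U * V)) :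
  (forall (W : lmodType K) (f : U -> V -> W),
     bilinear_map f -> balanced f -> formal_eval f s = formal_eval f t) ->
  \pi_({eq_quot formal_eq}) s = \pi_({eq_quot formal_eq}) t.
Proof. by move=> h; apply/eqmodP/asboolP. Qed.

Lemma formal_repr (s : seq (U * V)) (W : lmodType K) (f : U -> V -> W) :
  bilinear_map f -> balanced f ->
  formal_eval f (repr (\pi_({eq_quot formal_eq}) s)) = formal_eval f s.
Proof.
move=> hf bf; have /eqmodP/asboolP : repr (\pi_({eq_quot formal_eq}) s) = s
  %[mod {eq_quot formal_eq}] by rewrite reprK.
exact.
Qed.

(* For a balanced bilinear f this is the linear map induced by f; for other f
   the value depends on the representative chosen by [repr]. *)
Definition tlift (W : nmodType) (f : U -> V -> W) (x : btensor) : W :=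
  formal_eval f (repr x).

Definition ten (u : U) (v : V) : btensor := \pi_({eq_quot formal_eq}) [:: (u, v)].

Let zero : btensor := \pi_({eq_quot formal_eq}) [::].
Let add x y : btensor := \pi_({eq_quot formal_eq}) (repr x ++ repr y).
Let scale (c : K) x : btensor :=
  \pi_({eq_quot formal_eq}) [seq (c *: p.1, p.2) | p <- repr x].
Let opp x : btensor := scale (-1) x.

Let liftZ (W : lmodType K) (f : U -> V -> W) :
  bilinear_map f -> balanced f ->
  forall c x, tlift f (scale c x) = c *: tlift f x.
Proof.
move=> hf bf c x.
rewrite /tlift /scale formal_repr // /formal_eval big_map scaler_sumr.
apply: eq_bigr => p _ /=; have [h _] := hf.
have h0 : f 0 p.2 = 0 by have := h p.2 (-1) p.1 p.1; rewrite !scaleN1r !addNr.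
by have := h p.2 c p.1 0; rewrite h0 !addr0.
Qed.

Let liftD (W : lmodType K) (f : U -> V -> W) :
  bilinear_map f -> balanced f ->
  forall x y, tlift f (add x y) = tlift f x + tlift f y.
Proof.
by move=> hf bf x y; rewrite /tlift /add formal_repr // /formal_eval big_cat.
Qed.

Let lift0 (W : lmodType K) (f : U -> V -> W) :
  bilinear_map f -> balanced f -> tlift f zero = 0.
Proof.
by move=> hf bf; rewrite /tlift /zero formal_repr // /formal_eval big_nil.
Qed.

Let tlift_rules := (liftZ, liftD, lift0).

Lemma tlift_ten (W : lmodType K) (f : U -> V -> W) :
  bilinear_map f -> balanced f -> forall u v, tlift f (ten u v) = f u v.
Proof.
by move=> hf bf u v; rewrite /tlift /ten formal_repr // /formal_eval big_seq1.
Qed.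

Let sep x y : (forall (W : lmodType K) (f : U -> V -> W),
  bilinear_map f -> balanced f -> tlift f x = tlift f y) -> x = y.
Proof. by move=> h; rewrite -[x]reprK -[y]reprK; apply: formal_piP. Qed.

Let addA : associative add.
Proof. by move=> x y z; apply: sep => W f hf bf; rewrite !tlift_rules // addrA. Qed.
Let addC : commutative add.
Proof. by move=> x y; apply: sep => W f hf bf; rewrite !tlift_rules // addrC. Qed.
Let add0 : left_id zero add.
Proof. by move=> x; apply: sep => W f hf bf; rewrite !tlift_rules // add0r. Qed.
Let addN : left_inverse zero opp add.
Proof.
by move=> x; apply: sep => W f hf bf; rewrite !tlift_rules // scaleN1r addNr.
Qed.

HB.instance Definition _ := GRing.isZmodule.Build btensor addA addC add0 addN.

Let scaleA a b x : scale a (scale b x) = scale (a * b) x.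
Proof. by apply: sep => W f hf bf; rewrite !tlift_rules // scalerA. Qed.
Let scale1 : left_id 1 scale.
Proof. by move=> x; apply: sep => W f hf bf; rewrite !tlift_rules // scale1r. Qed.
Let scaleDr : right_distributive scale +%R.
Proof.
by move=> a x y; apply: sep => W f hf bf; rewrite !tlift_rules // scalerDr.
Qed.
Let scaleDl x : {morph scale^~ x : a b / a + b}.
Proof.
by move=> a b; apply: sep => W f hf bf; rewrite !tlift_rules // scalerDl.
Qed.

HB.instance Definition _ :=
  GRing.Zmodule_isLmodule.Build K btensor scaleA scale1 scaleDr scaleDl.

Lemma tlift_linear (W : lmodType K) (f : U -> V -> W) :
  bilinear_map f -> balanced f -> linear (tlift f).
Proof. by move=> hf bf a x y; rewrite /= !tlift_rules. Qed.

Lemma ten_bilinear : bilinear_map ten.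
Proof.
split=> [v a u1 u2|u a v1 v2]; apply: sep => W f hf bf;
  rewrite !tlift_rules // !tlift_ten //; [exact: hf.1 | exact: hf.2].
Qed.

Lemma ten_balanced : balanced ten.
Proof. by move=> u i v; apply: sep => W f hf bf; rewrite !tlift_ten. Qed.

Lemma ten_ind (P : btensor -> Prop) :
  (forall u v, P (ten u v)) -> (forall x y, P x -> P y -> P (x + y)) ->
  P 0 -> forall x, P x.
Proof.
move=> Pt PD P0 x; rewrite -[x]reprK; elim: (repr x) => [//|[u v] s IHs].
suff -> : \pi_({eq_quot formal_eq}) ((u, v) :: s) =
          ten u v + \pi_({eq_quot formal_eq}) s :> btensor by apply: PD.
apply: sep => W f hf bf; rewrite !tlift_rules // tlift_ten //.
by rewrite /tlift !formal_repr // /formal_eval big_cons.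
Qed.

End BalancedTensor.

Section Tensor.
Variables (K : fieldType) (U V : lmodType K).

Definition no_ract (u : U) (_ : void) : U := u.
Definition no_lact (_ : void) (v : V) : V := v.

Definition tensor : lmodType K := btensor no_ract no_lact.

Definition pure (u : U) (v : V) : tensor := ten no_ract no_lact u v.

End Tensor.

Notation "u ⊗ v" := (pure u v) (at level 40, left associativity) : ring_scope.

(* Sweedler sums: \sw_(x, y <- t) E is the image of t under the linear map
   induced by (x, y) |-> E; it is only used for E bilinear (and, for t in
   A (x)_B A, balanced) in (x, y). *)
Notation "\sw_ ( x , y <- t ) E" := (tlift (fun x y => E) t)
  (at level 41, x name, y name, t at level 200, E at level 41,
   right associativity) : ring_scope.

HB.mixin Record isCoalgebra (K : fieldType) C of GRing.Lmodule K C := {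
  comul : {linear C -> tensor C C};
  counit : {scalar C};
  comulA : forall c,
    \sw_(x, y <- comul c) \sw_(x1, x2 <- comul x) x1 ⊗ (x2 ⊗ y) =
    \sw_(x, y <- comul c) x ⊗ comul y;
  counitl : forall c, \sw_(x, y <- comul c) counit x *: y = c;
  counitr : forall c, \sw_(x, y <- comul c) counit y *: x = c
}.

#[short(type="coalgType")]
HB.structure Definition Coalgebra (K : fieldType) :=
  {C of GRing.Lmodule K C & isCoalgebra K C}.

HB.mixin Record isComodule (K : fieldType) (C : coalgType K) M
    of GRing.Lmodule K M := {
  coact : {linear M -> tensor M C};
  coactA : forall m,
    \sw_(x, c <- coact m) \sw_(x0, x1 <- coact x) x0 ⊗ (x1 ⊗ c) =
    \sw_(x, c <- coact m) x ⊗ comul c;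
  coact1 : forall m, \sw_(x, c <- coact m) counit c *: x = m
}.

#[short(type="comodType")]
HB.structure Definition Comodule (K : fieldType) (C : coalgType K) :=
  {M of GRing.Lmodule K M & isComodule K C M}.

(* Several products are considered on one vector space, and the zero algebra
   is allowed (unlike in algType), so operations and axioms are separate. *)
Record algOps (K : fieldType) (V : lmodType K) := AlgOps {
  amul : V -> V -> V;
  aone : V
}.

Record is_algebra (K : fieldType) (V : lmodType K) (R : algOps V) : Prop := {
  amul_bilinear : bilinear_map (amul R);
  amulA : associative (amul R);
  amul1l : left_id (aone R) (amul R);
  amul1r : right_id (aone R) (amul R)
}.

Definition tmul (K : fieldType) (U V : lmodType K)
    (R : algOps U) (S : algOps V) (s t : tensor U V) : tensor U V :=
  \sw_(u, v <- s) \sw_(u', v' <- t) amul R u u' ⊗ amul S v v'.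

Record hopfOps (K : fieldType) (H : coalgType K) := HopfOps {
  hopf_alg :> algOps H;
  antipode : H -> H
}.

Record is_hopf (K : fieldType) (H : coalgType K) (R : hopfOps H) : Prop := {
  hopf_is_algebra : is_algebra R;
  comul_one : comul (aone R) = aone R ⊗ aone R;
  comul_mul : forall g h, comul (amul R g h) = tmul R R (comul g) (comul h);
  counit_one : counit (aone R) = 1;
  counit_mul : forall g h, counit (amul R g h) = counit g * counit h;
  antipode_linear : linear (antipode R);
  antipodel : forall h,
    \sw_(h1, h2 <- comul h) amul R (antipode R h1) h2 = counit h *: aone R;
  antipoder : forall h,
    \sw_(h1, h2 <- comul h) amul R h1 (antipode R h2) = counit h *: aone R
}.

Record is_comodule_algebra (K : fieldType) (H : coalgType K) (R : hopfOps H)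
    (A : comodType H) (P : algOps A) : Prop := {
  comodalg_is_algebra : is_algebra P;
  coact_one : coact (aone P) = aone P ⊗ aone R;
  coact_mul : forall a b, coact (amul P a b) = tmul P R (coact a) (coact b)
}.

Section Coinvariants.
Variables (K : fieldType) (H : coalgType K) (R : hopfOps H) (A : comodType H).

Definition coinv_pred : {pred A} := [pred b | coact b == b ⊗ aone R].

Lemma coinv_submod : submod_closed coinv_pred.
Proof.
have [hl _] := ten_bilinear (@no_ract K A) (@no_lact K H).
have add1 (a : K) (u v : A) :
  (a *: u + v) ⊗ aone R = a *: (u ⊗ aone R) + v ⊗ aone R by exact: hl.
split=> [|a u v]; rewrite !inE.
  have := add1 (-1) 0 0; rewrite !scaleN1r !addNr => ->.
  by rewrite linear0.
by move=> /eqP hu /eqP hv; rewrite linearP hu hv add1.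
Qed.

HB.instance Definition _ :=
  GRing.isSubmodClosed.Build K A coinv_pred coinv_submod.

Record coinv : Type := Coinv { coinv_val : A; _ : coinv_val \in coinv_pred }.

HB.instance Definition _ := [isSub for coinv_val].
HB.instance Definition _ := [Choice of coinv by <:].
HB.instance Definition _ := [SubChoice_isSubLmodule of coinv by <:].

End Coinvariants.

Arguments coinv_pred {K H} R A _.
Arguments coinv {K H} R A.

Section Principal.
Variables (K : fieldType) (H : coalgType K) (R : hopfOps H).
Variables (A : comodType H) (P : algOps A).

Local Notation B := (coinv R A).

Definition coinv_ract (a : A) (b : B) : A := amul P a (val b).
Definition coinv_lact (b : B) (a : A) : A := amul P (val b) a.

Definition balanced_tensor : lmodType K := btensor coinv_ract coinv_lact.

Definition canonical_map (t : balanced_tensor) : tensor A H :=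
  \sw_(a, a' <- t) \sw_(a0, a1 <- coact a') amul P a a0 ⊗ a1.

Definition hopf_galois : Prop := bijective canonical_map.

Lemma coinv_mul_subproof (hR : is_hopf R) (hA : is_comodule_algebra R P)
  (b b' : B) : amul P (val b) (val b') \in coinv_pred R A.
Proof.
have /eqP hb := valP b; have /eqP hb' := valP b'.
rewrite inE (coact_mul hA) hb hb' /tmul.
have bP := amul_bilinear (comodalg_is_algebra hA).
have bR := amul_bilinear (hopf_is_algebra hR).
have [t1 t2] := ten_bilinear (@no_ract K A) (@no_lact K H).
have bil u v : bilinear_map (fun u' v' => amul P u u' ⊗ amul R v v').
  split=> [w|w] a x y /=; first by rewrite (bP.2 u); apply: t1.
  by rewrite (bR.2 v); apply: t2.
rewrite tlift_ten //; first by rewrite tlift_ten // (amul1l (hopf_is_algebra hR)).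
split=> [w|w] a x y /=; rewrite !tlift_ten //.
  by rewrite (bP.1 _ a x y); apply: t1.
by rewrite (bR.1 _ a x y); apply: t2.
Qed.

Definition coinv_mul (hR : is_hopf R) (hA : is_comodule_algebra R P)
  (b b' : B) : B := Coinv (coinv_mul_subproof hR hA b b').

Definition equivariantly_projective
    (hR : is_hopf R) (hA : is_comodule_algebra R P) : Prop :=
  exists s : {linear A -> tensor B A},
    [/\ forall (b : B) (a : A),
          s (amul P (val b) a) = \sw_(b', a' <- s a) coinv_mul hR hA b b' ⊗ a',
        forall a : A,
          \sw_(a0, a1 <- coact a) s a0 ⊗ a1 =
          \sw_(b, a' <- s a) \sw_(a0, a1 <- coact a') (b ⊗ a0) ⊗ a1
      & forall a : A, \sw_(b, a' <- s a) amul P (val b) a' = a].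

Definition principal : Prop :=
  exists (hR : is_hopf R) (hA : is_comodule_algebra R P),
    hopf_galois /\ equivariantly_projective hR hA.

End Principal.

Section Twist.
Variables (K : fieldType) (H : coalgType K) (R : hopfOps H).

Definition convolution_inverse (f g : {scalar (tensor H H)}) : Prop :=
  forall h k,
    \sw_(h1, h2 <- comul h) \sw_(k1, k2 <- comul k)
      (f (h1 ⊗ k1) * g (h2 ⊗ k2)) = counit h * counit k /\
    \sw_(h1, h2 <- comul h) \sw_(k1, k2 <- comul k)
      (g (h1 ⊗ k1) * f (h2 ⊗ k2)) = counit h * counit k.

(* The convolution inverse gb of ga is unique, so it may be kept explicit. *)
Record is_cocycle (ga gb : {scalar (tensor H H)}) : Prop := {
  cocycle_inv : convolution_inverse ga gb;
  cocycle1r : forall h, ga (h ⊗ aone R) = counit h;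
  cocycle1l : forall h, ga (aone R ⊗ h) = counit h;
  cocycleP : forall g h k,
    \sw_(g1, g2 <- comul g) \sw_(h1, h2 <- comul h)
      (ga (g1 ⊗ h1) * ga (amul R g2 h2 ⊗ k)) =
    \sw_(h1, h2 <- comul h) \sw_(k1, k2 <- comul k)
      (ga (h1 ⊗ k1) * ga (g ⊗ amul R h2 k2))
}.

Variables (ga gb : {scalar (tensor H H)}).

Definition twist_mul (h k : H) : H :=
  \sw_(h1, h' <- comul h) \sw_(h2, h3 <- comul h')
  \sw_(k1, k' <- comul k) \sw_(k2, k3 <- comul k')
    (ga (h1 ⊗ k1) * gb (h3 ⊗ k3)) *: amul R h2 k2.

Definition twist_u (h : H) : K := \sw_(h1, h2 <- comul h) ga (h1 ⊗ antipode R h2).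

Definition twist_ub (h : H) : K := \sw_(h1, h2 <- comul h) gb (antipode R h1 ⊗ h2).

Definition twist_antipode (h : H) : H :=
  \sw_(h1, h' <- comul h) \sw_(h2, h3 <- comul h')
    (twist_u h1 * twist_ub h3) *: antipode R h2.

Definition twist_hopf : hopfOps H :=
  HopfOps (AlgOps twist_mul (aone R)) twist_antipode.

Definition twist_comodalg (A : comodType H) (P : algOps A) : algOps A :=
  AlgOps
    (fun a a' => \sw_(a0, a1 <- coact a) \sw_(a0', a1' <- coact a')
                   gb (a1 ⊗ a1') *: amul P a0 a0')
    (aone P).

End Twist.

(* Main.v *)
Require Import Defs.
From HB Require Import structures.
From mathcomp Require Import all_boot all_order all_algebra.
From mathcomp Require Import boolp.

(** Write [a ⊗ b ↦ a • b] for the product of [A_γ], [γ̄] for the inverse of [γ]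
and [B] for the coinvariants of [A].

The twist keeps the vector space and the coaction of [A], and, as [γ̄] is
normalized, it also keeps every product with a coinvariant factor:
[b • a = b a] and [a • b = a b] for [b] in [B] ([twist_mul_coinvl],
[twist_mul_coinvr]).  Hence [A] and [A_γ] have the same algebra of coinvariants,
the same left [B]-module structure and the same balanced tensor product.
Equivariant projectivity speaks of nothing else, so it is one and the same
condition for both ([twist_projective]).

The canonical maps [χ] and [χ_γ] are then two maps with the same source and the
same target.  With [u(h) = γ(h_1 ⊗ S h_2)], the cocycle condition gives
[γ(g h_1 ⊗ S h_2) = γ̄(g ⊗ h_1) u(h_2)] ([ga_shift]), which says exactly that
[shear ∘ χ = rescale ∘ χ_γ] ([canonical_map_twist]) for the linear maps
[shear (x ⊗ h) = γ(x_1 ⊗ S h_1) x_0 ⊗ h_2] and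
[rescale (x ⊗ h) = u(h_1) x ⊗ h_2] of [A ⊗ H] to itself.  Replacing [γ] by [γ̄]
inverts the first and replacing [u] by its convolution inverse
[ū(h) = γ̄(S h_1 ⊗ h_2)] inverts the second, so [χ] is bijective if and only if
[χ_γ] is ([twist_hopf_galois]).

It remains to see that [H_γ] is a Hopf algebra and [A_γ] a comodule algebra over
it.  The product of [H_γ] is the convolution product [γ * m * γ̄], where [m] is
the product of [H], and the coproduct sends it to
[(γ * m) ⊗ (m * γ̄)] ([comul_mulT]); so a threefold product carries [γ] on
its first legs and [γ̄] on its last ones, and associativity is the cocycle
condition for [γ] together with the reversed condition for [γ̄] ([cocycle_mulL],
[cocycle_mulR]).  The antipode of [H_γ] works because [u] and [ū] are mutually
inverse and because the functionals [ū(h_2) γ(S h_1 ⊗ h_3)] and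
[u(h_2) γ̄(h_1 ⊗ S h_3)] are the counit ([ub_ga_cancel], [u_gb_cancel]).

All facts about cocycles come from one place.  The dual of the coalgebra
[H ⊗ (H ⊗ H)] is an algebra under convolution, in which the cocycle condition
reads [a b = c d] with four invertible elements.  With bars for inverses, the
reversed condition [b̄ ā = d̄ c̄] and the two mixed identities [ā c = b d̄] and
[c̄ a = d b̄] ([inverse_cocycle], [cocycle_cancel]) follow by cancellation.  This is why tensor
products of coalgebras and of comodules are made into coalgebras and comodules:
a computation with pairs or triples becomes a computation with one variable. *)

Set Implicit Arguments.
Unset Strict Implicit.
Unset Printing Implicit Defensive.

Import GRing.Theory.
Local Open Scope ring_scope.

(** * Linear maps and Sweedler sums *)

(** [K] as a module over itself, kept folded so that a sum of scalars and a sum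
of vectors over the same tensor can be compared by unification. *)
Definition Sc (K : fieldType) : lmodType K := K^o.

(** A name for [linear] with both modules visible in the head, on which
[lin_step] can match. *)
Definition lin (K : fieldType) (U V : lmodType K) (f : U -> V) : Prop :=
  linear f.

Notation linK f := (@lin _ _ (Sc _) f).
Notation bilinK f := (@bilinear_map _ _ _ (Sc _) f).

Section Multilinear.
Variable K : fieldType.
Implicit Types U V W X : lmodType K.

Lemma lin_id U : lin (fun x : U => x).
Proof. by []. Qed.

Lemma linD U V (f : U -> V) : lin f -> {morph f : x y / x + y}.
Proof. by move=> lf x y; have := lf 1 x y; rewrite !scale1r. Qed.

Lemma lin0 U V (f : U -> V) : lin f -> f 0 = 0.
Proof. by move=> lf; apply: (@addrI _ (f 0)); rewrite -linD // !addr0. Qed.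

Lemma linZ U V (f : U -> V) a x : lin f -> f (a *: x) = a *: f x.
Proof. by move=> lf; rewrite -[a *: x]addr0 lf lin0 // addr0. Qed.

Lemma lin_sum U V (f : U -> V) (I : Type) (r : seq I) (F : I -> U) :
  lin f -> f (\sum_(i <- r) F i) = \sum_(i <- r) f (F i).
Proof. by move=> lf; apply: big_morph; [exact: linD | exact: lin0]. Qed.

Lemma lin_comp U V W (f : V -> W) (g : U -> V) :
  lin f -> lin g -> lin (fun x => f (g x)).
Proof. by move=> lf lg a x y; rewrite lg lf. Qed.

Lemma lin_map U V W (f : {linear V -> W}) (g : U -> V) :
  lin g -> lin (fun x => f (g x)).
Proof. by move=> lg; apply: lin_comp => //; apply: linearP. Qed.

Lemma lin_scalar U V (f : {scalar V}) (g : U -> V) :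
  lin g -> @lin K U (Sc K) (fun x => f (g x)).
Proof. by move=> lg; apply: (@lin_comp _ _ (Sc K)) => //; apply: linearP. Qed.

Lemma lin_bil1 U V W X (f : V -> W -> X) (bf : bilinear_map f) (g : U -> V) w :
  lin g -> lin (fun x => f (g x) w).
Proof. by move=> lg a x y; rewrite lg (bf.1 w). Qed.

Lemma lin_bil2 U V W X (f : V -> W -> X) (bf : bilinear_map f) (g : U -> W) v :
  lin g -> lin (fun x => f v (g x)).
Proof. by move=> lg a x y; rewrite lg (bf.2 v). Qed.

Lemma bilin_intro U V W (f : U -> V -> W) :
  (forall v, lin (fun u => f u v)) -> (forall u, lin (fun v => f u v)) ->
  bilinear_map f.
Proof. by []. Qed.

Lemma pure_bilinear U V : bilinear_map (@pure K U V).
Proof. exact: ten_bilinear. Qed.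

Lemma scale_bilinear U : @bilinear_map K (Sc K) U U *:%R.
Proof.
by split=> [v a x y | u a x y]; rewrite ?scalerDl ?scalerDr !scalerA // mulrC.
Qed.

Lemma mul_bilinear : @bilinear_map K (Sc K) (Sc K) (Sc K) *%R.
Proof.
split=> [v a x y | u a x y]; rewrite ?mulrDl ?mulrDr /GRing.scale /= ?mulrA //.
by rewrite [a * _]mulrC.
Qed.

Lemma lin_sw U V W X (f : V -> W -> X) (g : U -> tensor V W) :
  bilinear_map f -> lin g -> lin (fun x => tlift f (g x)).
Proof. by move=> bf lg; apply: lin_comp => //; apply: tlift_linear. Qed.

Lemma lin_tlift_body U V W (I : Type) (ra : V -> I -> V) (la : I -> W -> W) X
  (f : U -> V -> W -> X) (t : btensor ra la) :
  (forall v w, lin (fun x => f x v w)) -> lin (fun x => tlift (f x) t).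
Proof.
move=> lf a x y; rewrite /tlift /formal_eval scaler_sumr -big_split /=.
by apply: eq_bigr => p _; rewrite lf.
Qed.

Lemma eq_tlift U V (I : Type) (ra : U -> I -> U) (la : I -> V -> V)
  (W : nmodType) (f g : U -> V -> W) (t : btensor ra la) :
  (forall u v, f u v = g u v) -> tlift f t = tlift g t.
Proof. by move=> fg; apply: eq_bigr => p _. Qed.

Lemma tlift_exch U V U' V' (I : Type) (ra : U -> I -> U) (la : I -> V -> V)
  (I' : Type) (ra' : U' -> I' -> U') (la' : I' -> V' -> V')
  (W : nmodType) (f : U -> V -> U' -> V' -> W)
  (t : btensor ra la) (t' : btensor ra' la') :
  \sw_(u, v <- t) \sw_(u', v' <- t') f u v u' v' =
  \sw_(u', v' <- t') \sw_(u, v <- t) f u v u' v'.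
Proof. exact: exchange_big. Qed.

Lemma lin_tlift_out U V (I : Type) (ra : U -> I -> U) (la : I -> V -> V)
  W X (g : W -> X) (f : U -> V -> W) (t : btensor ra la) :
  lin g -> g (\sw_(u, v <- t) f u v) = \sw_(u, v <- t) g (f u v).
Proof. exact: lin_sum. Qed.

Lemma scale_sw U V (I : Type) (ra : U -> I -> U) (la : I -> V -> V)
  W (f : U -> V -> W) (t : btensor ra la) a :
  a *: (\sw_(u, v <- t) f u v) = \sw_(u, v <- t) a *: f u v.
Proof. exact: scaler_sumr. Qed.

Lemma mulr_sw U V (I : Type) (ra : U -> I -> U) (la : I -> V -> V)
  (f : U -> V -> K) (t : btensor ra la) (a : K) :
  a * (\sw_(u, v <- t) f u v) = \sw_(u, v <- t) (a * f u v).
Proof. exact: mulr_sumr. Qed.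

Lemma sw_mulr U V (I : Type) (ra : U -> I -> U) (la : I -> V -> V)
  (f : U -> V -> K) (t : btensor ra la) (a : K) :
  (\sw_(u, v <- t) f u v) * a = \sw_(u, v <- t) (f u v * a).
Proof. exact: mulr_suml. Qed.

Lemma sw_scale U V (I : Type) (ra : U -> I -> U) (la : I -> V -> V)
  W (f : U -> V -> K) (t : btensor ra la) (w : W) :
  (\sw_(u, v <- t) f u v) *: w = \sw_(u, v <- t) f u v *: w.
Proof. exact: scaler_suml. Qed.

Lemma swE U V W (f : U -> V -> W) u v :
  bilinear_map f -> tlift f (u ⊗ v) = f u v.
Proof. by move=> bf; apply: tlift_ten. Qed.

Lemma swEK U V (f : U -> V -> K) u v :
  bilinK f -> tlift f (u ⊗ v) = f u v.
Proof. exact: (@swE U V (Sc K)). Qed.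

Lemma sw_nest U V U' V' W (F : U -> V -> W) (G : U' -> V' -> tensor U V)
   (t : tensor U' V') : bilinear_map F ->
  \sw_(u, v <- tlift G t) F u v = \sw_(x, y <- t) \sw_(u, v <- G x y) F u v.
Proof.
by move=> bF; apply: (lin_tlift_out (g := fun s => tlift F s)); apply: tlift_linear.
Qed.

Lemma tensor_ext U V W (f g : tensor U V -> W) :
  lin f -> lin g -> (forall u v, f (u ⊗ v) = g (u ⊗ v)) -> f =1 g.
Proof.
move=> lf lg fg; elim/ten_ind=> [u v | x y fx fy |]; first exact: fg.
  by rewrite !linD // fx fy.
by rewrite !lin0.
Qed.

Lemma sw_pure U V (t : tensor U V) : \sw_(u, v <- t) u ⊗ v = t.
Proof.
move: t; apply: tensor_ext => [||u v]; last by rewrite swE //; apply: pure_bilinear.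
- by apply: tlift_linear => //; apply: pure_bilinear.
- exact: lin_id.
Qed.

End Multilinear.

(** A Sweedler sum over a coproduct is meaningful only if its summand is
multilinear, so nearly every rewriting step below has linearity side conditions.
[lin_tac] discharges them by following the syntax of the map; [lin_unfold] is
redefined later to open the definitions through which it has to look. *)
Ltac lin_unfold := fail.

Ltac lin_step := cbv beta;
  first
  [ assumption
  | solve [auto 1 with nocore]
  | match goal with
    | |- forall _, _ => intro
    | |- _ /\ _ => split
    | |- is_true true => reflexivity
    | |- bilinear_map (@pure _ _ _) => apply: pure_bilinear
    | |- bilinear_map _ => apply: bilin_intro; intro
    | |- lin (fun x => x) => apply: lin_id
    | |- @lin _ ?U ?X (fun x => tlift (@?F x) ?t) =>
        apply: (@lin_tlift_body _ U _ _ _ _ _ X F t)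
    | |- @lin _ ?U ?X (fun x => tlift ?F (@?t x)) =>
        apply: (@lin_sw _ U _ _ X F t)
    | |- @lin _ ?U ?X (fun x => @pure _ _ _ (@?a x) ?b) =>
        apply: (@lin_bil1 _ U _ _ X _ (@pure_bilinear _ _ _) a b)
    | |- @lin _ ?U ?X (fun x => @pure _ _ _ ?b (@?a x)) =>
        apply: (@lin_bil2 _ U _ _ X _ (@pure_bilinear _ _ _) a b)
    | |- @lin _ ?U ?X (fun x => GRing.scale (@?a x) ?b) =>
        apply: (@lin_bil1 _ U _ _ X _ (@scale_bilinear _ _) a b)
    | |- @lin _ ?U ?X (fun x => GRing.scale ?b (@?a x)) =>
        apply: (@lin_bil2 _ U _ _ X _ (@scale_bilinear _ _) a b)
    | |- @lin _ ?U ?X (fun x => GRing.mul (@?a x) ?b) =>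
        apply: (@lin_bil1 _ U _ _ X _ (@mul_bilinear _) a b)
    | |- @lin _ ?U ?X (fun x => GRing.mul ?b (@?a x)) =>
        apply: (@lin_bil2 _ U _ _ X _ (@mul_bilinear _) a b)
    | h : @bilinear_map ?K ?V ?W ?X ?op |- @lin _ ?U _ (fun x => ?op (@?a x) ?b) =>
        apply: (@lin_bil1 K U V W X op h a b)
    | h : @bilinear_map ?K ?V ?W ?X ?op |- @lin _ ?U _ (fun x => ?op ?b (@?a x)) =>
        apply: (@lin_bil2 K U V W X op h a b)
    | h : @lin ?K ?V ?X ?f |- @lin _ ?U _ (fun x => ?f (@?a x)) =>
        apply: (@lin_comp K U V X f a h)
    | |- @lin _ ?U _ (fun x => GRing.Linear.sort ?f (@?a x)) =>
        first [ apply: (@lin_map _ U _ _ f a) | apply: (@lin_scalar _ U _ f a) ]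
    | |- @lin _ ?U ?X (fun x => ?G (@?a x) ?b ?c) =>
        apply: (@lin_comp _ U _ X (fun z => G z b c) a); [solve [auto 1 with nocore] | ]
    | |- @lin _ ?U ?X (fun x => ?G ?b (@?a x) ?c) =>
        apply: (@lin_comp _ U _ X (fun z => G b z c) a); [solve [auto 1 with nocore] | ]
    | |- @lin _ ?U ?X (fun x => ?G ?b ?c (@?a x)) =>
        apply: (@lin_comp _ U _ X (fun z => G b c z) a); [solve [auto 1 with nocore] | ]
    | |- @lin ?K ?U ?V ?f =>
        lazymatch f with
        | (fun _ => _) => fail
        | _ => change (@lin K U V (fun x => f x))
        end
    | |- lin _ => lin_unfold
    end ].

Ltac lin_tac := solve [repeat lin_step].

#[local] Hint Extern 0 (lin _) => lin_tac : core.
#[local] Hint Extern 0 (bilinear_map _) => lin_tac : core.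

(** * Iterated Sweedler sums and tensor products of comodules *)

Section ComoduleSums.
Variables (K : fieldType) (C : coalgType K) (M : comodType C).
Implicit Types W : lmodType K.

Lemma sw_coact_assoc W (F : M -> C -> C -> W) m :
  (forall y z, lin (fun x => F x y z)) -> (forall x z, lin (fun y => F x y z)) ->
  (forall x y, lin (fun z => F x y z)) ->
  \sw_(x, z <- coact m) \sw_(x1, x2 <- coact x) F x1 x2 z =
  \sw_(x, y <- coact m) \sw_(y1, y2 <- comul y) F x y1 y2.
Proof.
move=> F1 F2 F3.
have := congr1 (fun s => \sw_(x, p <- s) \sw_(y, z <- p) F x y z) (coactA m).
rewrite /= !sw_nest; try lin_tac.
move=> e; etransitivity; last first; [etransitivity; [exact: e|]|].
  by apply: eq_tlift => x y; rewrite swE //; lin_tac.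
symmetry.
apply: eq_tlift => x y; rewrite sw_nest; last by lin_tac.
by apply: eq_tlift => x' y'; rewrite swE ?swE //; lin_tac.
Qed.

Lemma sw_coact_counit W (F : M -> W) m :
  lin F -> \sw_(x, y <- coact m) counit y *: F x = F m.
Proof.
move=> lF; rewrite -[in RHS](coact1 m) lin_tlift_out //.
by apply: eq_tlift => x y; rewrite linZ.
Qed.

End ComoduleSums.

Section RegularComodule.
Variables (K : fieldType) (C : coalgType K).
Implicit Types W : lmodType K.

(** [C] coacting on itself; statements about coproducts become instances of
statements about coactions. *)
Definition coreg : Type := C.
HB.instance Definition _ := GRing.Lmodule.on coreg.
HB.instance Definition _ :=
  isComodule.Build K C coreg (@comulA K C) (@counitr K C).

Lemma sw_assoc W (F : C -> C -> C -> W) c :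
  (forall y z, lin (fun x => F x y z)) -> (forall x z, lin (fun y => F x y z)) ->
  (forall x y, lin (fun z => F x y z)) ->
  \sw_(x, z <- comul c) \sw_(x1, x2 <- comul x) F x1 x2 z =
  \sw_(x, y <- comul c) \sw_(y1, y2 <- comul y) F x y1 y2.
Proof. exact: (@sw_coact_assoc _ _ coreg). Qed.

Lemma sw_counitr W (F : C -> W) c :
  lin F -> \sw_(x, y <- comul c) counit y *: F x = F c.
Proof. exact: (@sw_coact_counit _ _ coreg). Qed.

Lemma sw_counitl W (F : C -> W) c :
  lin F -> \sw_(x, y <- comul c) counit x *: F y = F c.
Proof.
move=> lF; rewrite -[in RHS](counitl c) lin_tlift_out //.
by apply: eq_tlift => x y; rewrite linZ.
Qed.

End RegularComodule.

Section TensorComodule.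
Variables (K : fieldType) (C D : coalgType K).

Definition tensor_coact (M : comodType C) (N : comodType D) (t : tensor M N) :
    tensor (tensor M N) (tensor C D) :=
  tlift (fun (m : M) (n : N) => \sw_(m0, m1 <- coact m) \sw_(n0, n1 <- coact n)
    (m0 ⊗ n0) ⊗ (m1 ⊗ n1)) t.

Definition tensor_counit (t : tensor C D) : K :=
  tlift (fun (c : C) (d : D) => counit c * counit d ) t.

Lemma tensor_coact_linear (M : comodType C) (N : comodType D) :
  linear (@tensor_coact M N).
Proof. by change (lin (@tensor_coact M N)); rewrite /tensor_coact; lin_tac. Qed.

Lemma tensor_counit_scalar : scalar tensor_counit.
Proof.
by change (linK tensor_counit); rewrite /tensor_counit; lin_tac.
Qed.

HB.instance Definition _ (M : comodType C) (N : comodType D) :=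
  GRing.isLinear.Build K (tensor M N) (tensor (tensor M N) (tensor C D)) _
    (@tensor_coact M N) (@tensor_coact_linear M N).
HB.instance Definition _ :=
  GRing.isLinear.Build K (tensor C D) K _ tensor_counit tensor_counit_scalar.

Lemma tensor_coactE (M : comodType C) (N : comodType D)
    (W : lmodType K) (F : tensor M N -> tensor C D -> W) m n :
  bilinear_map F ->
  tlift F (tensor_coact (m ⊗ n)) =
  \sw_(m0, m1 <- coact m) \sw_(n0, n1 <- coact n) F (m0 ⊗ n0) (m1 ⊗ n1).
Proof.
move=> bF; rewrite /tensor_coact swE; last by lin_tac.
rewrite sw_nest //; apply: eq_tlift => m0 m1.
by rewrite sw_nest //; apply: eq_tlift => n0 n1; rewrite swE.
Qed.

Lemma tensor_counitE c d : tensor_counit (c ⊗ d) = counit c * counit d.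
Proof. by rewrite /tensor_counit swEK //; lin_tac. Qed.

Definition tensor_comul : tensor C D -> tensor (tensor C D) (tensor C D) :=
  @tensor_coact (coreg C) (coreg D).

Lemma tensor_comulE (W : lmodType K) (F : tensor C D -> tensor C D -> W) c d :
  bilinear_map F ->
  tlift F (tensor_comul (c ⊗ d)) =
  \sw_(c1, c2 <- comul c) \sw_(d1, d2 <- comul d) F (c1 ⊗ d1) (c2 ⊗ d2).
Proof. exact: (@tensor_coactE (coreg C) (coreg D) W F c d). Qed.

Lemma tensor_comul_linear : linear tensor_comul.
Proof. exact: (@tensor_coact_linear (coreg C) (coreg D)). Qed.

HB.instance Definition _ :=
  GRing.isLinear.Build K (tensor C D) (tensor (tensor C D) (tensor C D)) _
    tensor_comul tensor_comul_linear.

(** On pure tensors the two coactions interleave; exchanging the two sums of the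
middle separates them and coassociativity applies to each factor. *)
Lemma tensor_coactA (M : comodType C) (N : comodType D) (t : tensor M N) :
  \sw_(x, c <- tensor_coact t) \sw_(x0, x1 <- tensor_coact x) x0 ⊗ (x1 ⊗ c) =
  \sw_(x, c <- tensor_coact t) x ⊗ tensor_comul c.
Proof.
have lc : lin tensor_comul by exact: (@tensor_coact_linear (coreg C) (coreg D)).
have la : lin (@tensor_coact M N) by exact: tensor_coact_linear.
move: t; apply: tensor_ext => // m n.
rewrite !tensor_coactE //.
under eq_tlift => m0 m1.
  under eq_tlift => n0 n1 do rewrite tensor_coactE //.
  rewrite tlift_exch.
  under eq_tlift => m00 m01 do rewrite sw_coact_assoc //.
  over.
rewrite sw_coact_assoc //.
apply: eq_tlift => m0 m1; rewrite tlift_exch; apply: eq_tlift => n0 n1.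
rewrite -[tensor_comul _]/(tensor_coact (M := coreg C) (N := coreg D) (m1 ⊗ n1)).
rewrite /tensor_coact swE // lin_tlift_out //; apply: eq_tlift => m2 m3.
by rewrite lin_tlift_out.
Qed.

Lemma tensor_counit_coact (M : comodType C) (N : comodType D) (t : tensor M N) :
  \sw_(x, c <- tensor_coact t) tensor_counit c *: x = t.
Proof.
have la : lin (@tensor_coact M N) by exact: tensor_coact_linear.
have lc : linK tensor_counit by exact: tensor_counit_scalar.
move: t; apply: tensor_ext => // m n.
rewrite tensor_coactE //.
under eq_tlift => m0 m1.
  under eq_tlift => n0 n1 do rewrite tensor_counitE mulrC -scalerA.
  rewrite (sw_coact_counit (F := fun n0 => counit m1 *: (m0 ⊗ n0))) //.
  over.
by rewrite (sw_coact_counit (F := fun m0 => m0 ⊗ n)).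
Qed.

Lemma tensor_counit_comull (t : tensor C D) :
  \sw_(c, x <- tensor_comul t) tensor_counit c *: x = t.
Proof.
have la : lin tensor_comul by exact: (@tensor_coact_linear (coreg C) (coreg D)).
have lc : linK tensor_counit by exact: tensor_counit_scalar.
move: t; apply: tensor_ext => // c d.
rewrite tensor_comulE //.
under eq_tlift => m0 m1.
  under eq_tlift => n0 n1 do rewrite tensor_counitE mulrC -scalerA.
  rewrite (sw_counitl (F := fun n0 => counit m0 *: (m1 ⊗ n0))) //.
  over.
by rewrite (sw_counitl (F := fun m0 => m0 ⊗ d)).
Qed.

Lemma tensor_comulA (t : tensor C D) :
  \sw_(x, y <- tensor_comul t) \sw_(x1, x2 <- tensor_comul x) x1 ⊗ (x2 ⊗ y) =
  \sw_(x, y <- tensor_comul t) x ⊗ tensor_comul y.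
Proof. exact: (@tensor_coactA (coreg C) (coreg D)). Qed.

Lemma tensor_counit_comulr (t : tensor C D) :
  \sw_(x, c <- tensor_comul t) tensor_counit c *: x = t.
Proof. exact: (@tensor_counit_coact (coreg C) (coreg D)). Qed.

End TensorComodule.

HB.instance Definition _ (K : fieldType) (C D : coalgType K) :=
  isCoalgebra.Build K (tensor C D)
    (@tensor_comulA K C D) (@tensor_counit_comull K C D)
    (@tensor_counit_comulr K C D).

(** The coalgebra [C ⊗ D]; the name lets it serve as a parameter of [comodType]. *)
Definition tensor_coalg (K : fieldType) (C D : coalgType K) : coalgType K :=
  (tensor C D : Type).

HB.instance Definition _ (K : fieldType) (C D : coalgType K)
    (M : comodType C) (N : comodType D) :=
  isComodule.Build K (tensor_coalg C D) (tensor M N)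
    (@tensor_coactA K C D M N) (@tensor_counit_coact K C D M N).

Section ScalarSums.
Variables (K : fieldType) (C D : coalgType K).

Lemma sw_counitlK (F : C -> K) c :
  linK F -> \sw_(x, y <- comul c) counit x * F y = F c.
Proof. exact: (@sw_counitl K C (Sc K)). Qed.

Lemma sw_counitrK (F : C -> K) c :
  linK F -> \sw_(x, y <- comul c) counit y * F x = F c.
Proof. exact: (@sw_counitr K C (Sc K)). Qed.

Lemma comul_pure (W : lmodType K) (F : tensor C D -> tensor C D -> W) c d :
  bilinear_map F ->
  \sw_(x, y <- comul (c ⊗ d)) F x y =
  \sw_(c1, c2 <- comul c) \sw_(d1, d2 <- comul d) F (c1 ⊗ d1) (c2 ⊗ d2).
Proof. exact: tensor_comulE. Qed.

Lemma comul_pureK (F : tensor C D -> tensor C D -> K) c d :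
  bilinK F ->
  \sw_(x, y <- comul (c ⊗ d)) F x y =
  \sw_(c1, c2 <- comul c) \sw_(d1, d2 <- comul d) F (c1 ⊗ d1) (c2 ⊗ d2).
Proof. exact: (@tensor_comulE K C D (Sc K)). Qed.

Lemma counit_pure (c : C) (d : D) : counit (c ⊗ d) = counit c * counit d.
Proof. exact: tensor_counitE. Qed.

Lemma coact_pure (M : comodType C) (N : comodType D) (W : lmodType K)
    (F : tensor M N -> tensor_coalg C D -> W) (m : M) (n : N) :
  bilinear_map F ->
  \sw_(x, y <- coact (m ⊗ n)) F x y =
  \sw_(m0, m1 <- coact m) \sw_(n0, n1 <- coact n) F (m0 ⊗ n0) (m1 ⊗ n1).
Proof. exact: tensor_coactE. Qed.

End ScalarSums.

(** * Convolution *)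

Section Convolution.
Variables (K : fieldType) (C : coalgType K).

Definition conv (f g : C -> K) (c : C) : K :=
  \sw_(x, y <- comul c) f x * g y.

Section Module.
Variables (M : comodType C) (W : lmodType K).
Implicit Types (f g : C -> K) (F : M -> W).

(** Functionals on [C] act on maps out of a [C]-comodule from the right, and on
maps out of [C] from the left as well. *)
Definition convr F f (m : M) : W := \sw_(x, c <- coact m) f c *: F x.

Definition convl f (F : C -> W) (c : C) : W :=
  \sw_(x, y <- comul c) f x *: F y.

Lemma convr_lin F f : lin F -> linK f -> lin (convr F f).
Proof. by move=> lF lf; rewrite /convr. Qed.

Lemma convl_lin f (F : C -> W) : linK f -> lin F -> lin (convl f F).
Proof. by move=> lF lf; rewrite /convl. Qed.

Lemma convr1 F : lin F -> convr F counit = F.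
Proof. by move=> lF; apply: funext => m; apply: sw_coact_counit. Qed.

Lemma convl1 (F : C -> W) : lin F -> convl counit F = F.
Proof. by move=> lF; apply: funext => m; apply: sw_counitl. Qed.

End Module.

Lemma convlA (W : lmodType K) (F : C -> W) (f g : C -> K) :
  lin F -> linK f -> linK g -> convl f (convl g F) = convl (conv f g) F.
Proof.
move=> lF lf lg; apply: funext => m; rewrite /convl /conv /=.
under eq_tlift => x c do rewrite scale_sw.
rewrite -sw_assoc //; apply: eq_tlift => x c.
rewrite sw_scale; by apply: eq_tlift => d e; rewrite scalerA.
Qed.

(** The coaction is balanced over the dual algebra: by coassociativity, a
functional acting on the last leg of the first factor acts on the first leg of
the second one. *)
Lemma convr_balance (M : comodType C) (U V W : lmodType K) (F : M -> U)
    (G : C -> V) (f : C -> K) (op : U -> V -> W) m :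
  lin F -> lin G -> linK f -> bilinear_map op ->
  \sw_(x, c <- coact m) op (convr F f x) (G c) =
  \sw_(x, c <- coact m) op (F x) (convl f G c).
Proof.
move=> lF lG lf bop; rewrite /convr /convl /=.
under eq_tlift => x c.
  rewrite (lin_tlift_out (g := fun u => op u (G c))) //.
  under eq_tlift => y d do rewrite (linZ (f := fun u => op u (G c))) //.
  over.
rewrite sw_coact_assoc //; apply: eq_tlift => x c.
rewrite (lin_tlift_out (g := op (F x))) //.
by apply: eq_tlift => d e; rewrite (linZ (f := op (F x))).
Qed.

Lemma convl_convr (W : lmodType K) (F : C -> W) (f g : C -> K) :
  lin F -> linK f -> linK g ->
  convl f (convr (M := coreg C) F g) = convr (M := coreg C) (convl f F) g.
Proof.
move=> lF lf lg; apply: funext => m; rewrite /convl /convr /=.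
under eq_tlift => x c do rewrite scale_sw.
rewrite -sw_assoc //; apply: eq_tlift => x c.
rewrite scale_sw; apply: eq_tlift => d e.
by rewrite !scalerA mulrC.
Qed.

Lemma conv_linK (f g : C -> K) : linK f -> linK g -> linK (conv f g).
Proof. exact: (@convl_lin (Sc K)). Qed.

Lemma convA (f g h : C -> K) :
  linK f -> linK g -> linK h -> conv f (conv g h) = conv (conv f g) h.
Proof. by move=> lf lg lh; apply: (@convlA (Sc K)). Qed.

Lemma conv1f (f : C -> K) : linK f -> conv counit f = f.
Proof. exact: (@convl1 (Sc K)). Qed.

Lemma convf1 (f : C -> K) : linK f -> conv f counit = f.
Proof.
move=> lf; rewrite -[RHS](convr1 (M := coreg C) (W := Sc K)) //.
by apply: funext => m; apply: eq_tlift => x y; rewrite mulrC.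
Qed.

End Convolution.

Ltac lin_unfold ::= progress cbv delta [convr convl conv].

(** * Algebras, Hopf algebras and comodule algebras *)

Section TensorAlgebra.
Variables (K : fieldType) (U V : lmodType K) (R : algOps U) (S : algOps V).
Hypotheses (hR : is_algebra R) (hS : is_algebra S).

Let bR : bilinear_map (amul R) := amul_bilinear hR.
Let bS : bilinear_map (amul S) := amul_bilinear hS.

Lemma tmul_bilinear : bilinear_map (tmul R S).
Proof. by rewrite /tmul. Qed.

Lemma tmul_pure u v u' v' :
  tmul R S (u ⊗ v) (u' ⊗ v') = amul R u u' ⊗ amul S v v'.
Proof. by rewrite /tmul !swE. Qed.

Definition tensor_alg : algOps (tensor U V) :=
  AlgOps (tmul R S) (aone R ⊗ aone S).

Lemma tensor_is_algebra : is_algebra tensor_alg.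
Proof.
have bT := tmul_bilinear.
split=> //=.
- move=> x y z; move: x; apply: tensor_ext => // u v.
  move: y; apply: tensor_ext => // u' v'.
  move: z; apply: tensor_ext => // u'' v''.
  by rewrite !tmul_pure (amulA hR) (amulA hS).
- move=> x; move: x; apply: tensor_ext => // u v.
  by rewrite tmul_pure (amul1l hR) (amul1l hS).
- move=> x; move: x; apply: tensor_ext => // u v.
  by rewrite tmul_pure (amul1r hR) (amul1r hS).
Qed.

End TensorAlgebra.

Section CoactMul.
Variables (K : fieldType) (H : coalgType K) (R : hopfOps H).
Variables (A : comodType H) (P : algOps A).
Hypothesis hA : is_comodule_algebra R P.

Lemma coact_mul_sw (W : lmodType K) (F : A -> H -> W) a b :
  bilinear_map F ->
  \sw_(x, y <- coact (amul P a b)) F x y =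
  \sw_(a0, a1 <- coact a) \sw_(b0, b1 <- coact b)
    F (amul P a0 b0) (amul R a1 b1).
Proof.
move=> bF; rewrite (coact_mul hA) /tmul sw_nest //; apply: eq_tlift => a0 a1.
by rewrite sw_nest //; apply: eq_tlift => b0 b1; rewrite swE.
Qed.

End CoactMul.

Section Hopf.
Variables (K : fieldType) (H : coalgType K) (R : hopfOps H).
Hypothesis hR : is_hopf R.

Local Notation "1H" := (aone R).
Local Notation "x ∙ y" := (amul R x y) (at level 40, left associativity).
Local Notation S := (antipode R).

Let algR := hopf_is_algebra hR.
Let bR : bilinear_map (amul R) := amul_bilinear algR.
Let lS : lin S := antipode_linear hR.

Lemma hopf_comodule_algebra :
  is_comodule_algebra (A := coreg H) R (hopf_alg R).
Proof. by split; [exact: algR | exact: comul_one hR | exact: comul_mul hR]. Qed.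

Lemma counit_antipode h : counit (S h) = counit h.
Proof.
have := congr1 counit (antipodel hR h).
rewrite [in RHS]linearZ /= (counit_one hR) mulr1 => <-.
rewrite -[in LHS](counitr h).
rewrite (lin_tlift_out (g := S)) // (@lin_tlift_out K H H _ _ _ H (Sc K) counit) //.
rewrite (@lin_tlift_out K H H _ _ _ H (Sc K) counit) //.
apply: eq_tlift => x y; rewrite (linZ _ _ lS) linearZ /= (counit_mul hR).
by rewrite mulrC.
Qed.

Section Reassoc.
Variables (W : lmodType K).

(** Coassociativity says that only the order of the legs matters; these two
instances regroup four and five legs so that the inner ones sit together and can
be cancelled. *)
Lemma sw_regroup4 (F : H -> H -> H -> H -> W) h :
  (forall q r s, lin (fun p => F p q r s)) ->
  (forall p r s, lin (fun q => F p q r s)) ->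
  (forall p q s, lin (fun r => F p q r s)) ->
  (forall p q r, lin (fun s => F p q r s)) ->
  \sw_(x, y <- comul h) \sw_(p, q <- comul x) \sw_(r, s <- comul y) F p q r s =
  \sw_(p, z <- comul h) \sw_(x, s <- comul z) \sw_(q, r <- comul x) F p q r s.
Proof.
move=> F1 F2 F3 F4; rewrite sw_assoc //; apply: eq_tlift => p z.
by rewrite sw_assoc.
Qed.

Lemma sw_regroup5 (F : H -> H -> H -> H -> H -> W) h :
  (forall q r s t, lin (fun p => F p q r s t)) ->
  (forall p r s t, lin (fun q => F p q r s t)) ->
  (forall p q s t, lin (fun r => F p q r s t)) ->
  (forall p q r t, lin (fun s => F p q r s t)) ->
  (forall p q r s, lin (fun t => F p q r s t)) ->
  \sw_(x, y <- comul h) \sw_(r, z <- comul y)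
    \sw_(p, q <- comul x) \sw_(s, t <- comul z) F p q r s t =
  \sw_(p, z <- comul h) \sw_(x, t <- comul z)
    \sw_(q, y <- comul x) \sw_(r, s <- comul y) F p q r s t.
Proof.
move=> F1 F2 F3 F4 F5.
under eq_tlift => x y do rewrite tlift_exch.
rewrite sw_assoc //; apply: eq_tlift => p k.
rewrite sw_assoc //; apply: eq_tlift => q h'.
by rewrite sw_assoc.
Qed.

End Reassoc.

Lemma comul_mul_sw (W : lmodType K) (F : H -> H -> W) x y :
  bilinear_map F ->
  \sw_(u, v <- comul (x ∙ y)) F u v =
  \sw_(x1, x2 <- comul x) \sw_(y1, y2 <- comul y) F (x1 ∙ y1) (x2 ∙ y2).
Proof. exact: (coact_mul_sw hopf_comodule_algebra). Qed.

(** Both sides are convolution inverse to the coproduct, in the algebra of maps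
from [H] to [H ⊗ H]: the coproduct of [S] on the left because the coproduct is
multiplicative, the flipped one on the right because the legs [h_2] and [S h_3]
cancel before [h_1] and [S h_4] do. *)
Lemma comul_antipode h : comul (S h) = \sw_(h1, h2 <- comul h) S h2 ⊗ S h1.
Proof.
have bT := tmul_bilinear algR algR.
have algT := tensor_is_algebra algR algR.
pose G h := \sw_(h1, h2 <- comul h) S h2 ⊗ S h1.
have lG : lin G by rewrite /G.
have right k : \sw_(a, b <- comul k) tmul R R (comul a) (G b) =
    counit k *: (1H ⊗ 1H).
  transitivity (\sw_(a, b <- comul k) \sw_(p, q <- comul a) \sw_(r, s <- comul b)
      (p ∙ S s) ⊗ (q ∙ S r)).
    apply: eq_tlift => a b; rewrite -[comul a in LHS]sw_pure.
    rewrite (lin_tlift_out (g := fun t => tmul R R t (G b))) //.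
    apply: eq_tlift => p q; rewrite (lin_tlift_out (g := tmul R R _)) //.
    by apply: eq_tlift => r s; rewrite tmul_pure.
  rewrite sw_regroup4 //.
  under eq_tlift => p z.
    under eq_tlift => x s.
      rewrite -(lin_tlift_out (g := fun q => (p ∙ S s) ⊗ q)) // (antipoder hR).
      rewrite (linZ (f := fun q => (p ∙ S s) ⊗ q)) //.
      over.
    rewrite sw_counitl //.
    over.
  rewrite -(lin_tlift_out (g := fun q => q ⊗ 1H)) // (antipoder hR).
  by rewrite (linZ (f := fun q => q ⊗ 1H)).
have left k : \sw_(a, b <- comul k) tmul R R (comul (S a)) (comul b) =
    counit k *: (1H ⊗ 1H).
  under eq_tlift => a b do rewrite -(comul_mul hR).
  by rewrite -lin_tlift_out // (antipodel hR) linearZ /= (comul_one hR).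
rewrite -[LHS](sw_counitr (F := fun h => comul (S h))) //.
transitivity (\sw_(x, k <- comul h) tmul R R (comul (S x)) (counit k *: (1H ⊗ 1H))).
  apply: eq_tlift => x k; rewrite (linZ (f := tmul R R _)) //.
  by rewrite [tmul _ _ _ _](amul1r algT).
under eq_tlift => x k.
  rewrite -right (lin_tlift_out (g := tmul R R _)) //.
  under eq_tlift => a b do rewrite [tmul _ _ _ _](amulA algT) /=.
  over.
rewrite -sw_assoc //.
under eq_tlift => k b.
  rewrite -(lin_tlift_out (g := fun t => tmul R R t _)) // left.
  rewrite (linZ (f := fun t => tmul R R t _)) // [tmul _ _ _ _](amul1l algT).
  over.
by rewrite sw_counitl.
Qed.

Lemma comul_antipode_sw (W : lmodType K) (F : H -> H -> W) h :
  bilinear_map F ->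
  \sw_(x, y <- comul (S h)) F x y = \sw_(h1, h2 <- comul h) F (S h2) (S h1).
Proof.
move=> bF; rewrite comul_antipode sw_nest //.
by apply: eq_tlift => x y; rewrite swE.
Qed.

(** In [h_1 ⊗ h_2 ↦ S h_1 ⊗ h_2] the antipode reverses the legs, so that the
first leg of [S h_1] is adjacent to the first leg of [h_2] and they cancel;
[collapse_antipoder] is the mirror image. *)
Lemma collapse_antipodel (W : lmodType K) (G : H -> H -> H -> W) h :
  (forall y z, lin (fun x => G x y z)) -> (forall x z, lin (fun y => G x y z)) ->
  (forall x y, lin (fun z => G x y z)) ->
  \sw_(h1, h2 <- comul h) \sw_(x1, x2 <- comul (S h1)) \sw_(y1, y2 <- comul h2)
    G (x1 ∙ y1) x2 y2 =
  \sw_(h1, h2 <- comul h) G 1H (S h1) h2.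
Proof.
move=> G1 G2 G3.
under eq_tlift => h1 h2 do rewrite comul_antipode_sw //.
rewrite sw_regroup4 //; apply: eq_tlift => p z.
under eq_tlift => x s.
  rewrite -(lin_tlift_out (g := fun q => G q _ _)) // (antipodel hR).
  rewrite (linZ (f := fun q => G q _ _)) //.
  over.
by rewrite sw_counitl.
Qed.

Lemma collapse_antipoder (W : lmodType K) (G : H -> H -> H -> W) h :
  (forall y z, lin (fun x => G x y z)) -> (forall x z, lin (fun y => G x y z)) ->
  (forall x y, lin (fun z => G x y z)) ->
  \sw_(h1, h2 <- comul h) \sw_(x1, x2 <- comul h1) \sw_(y1, y2 <- comul (S h2))
    G x1 y1 (x2 ∙ y2) =
  \sw_(h1, h2 <- comul h) G h1 (S h2) 1H.
Proof.
move=> G1 G2 G3.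
under eq_tlift => h1 h2 do under eq_tlift => x1 x2 do rewrite comul_antipode_sw //.
rewrite sw_regroup4 //; apply: eq_tlift => p z.
under eq_tlift => x s.
  rewrite -(lin_tlift_out (g := fun q => G _ _ q)) // (antipoder hR).
  rewrite (linZ (f := fun q => G _ _ q)) //.
  over.
by rewrite sw_counitl.
Qed.

End Hopf.

(** * Coactions of twisted products *)

Section TwistedMul.
Variables (K : fieldType) (H : coalgType K) (R : hopfOps H).
Hypothesis hR : is_hopf R.

Local Notation HH := (tensor_coalg H H).
Local Notation "1H" := (aone R).
Local Notation S := (antipode R).

(** The product as a linear map on the tensor square, which is a comodule over
[H ⊗ H] when [V] is a comodule over [H]. *)
Definition mlt (V : lmodType K) (P : algOps V) : tensor V V -> V :=
  tlift (amul P).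

Lemma mlt_lin (V : lmodType K) (P : algOps V) : is_algebra P -> lin (mlt P).
Proof. by move=> hP; have bP := amul_bilinear hP; apply: lin_sw. Qed.

Lemma mlt_pure (V : lmodType K) (P : algOps V) a b :
  is_algebra P -> mlt P (a ⊗ b) = amul P a b.
Proof. by move=> hP; have bP := amul_bilinear hP; rewrite /mlt swE. Qed.

Section ComoduleAlgebra.
Variables (A : comodType H) (P : algOps A).
Hypothesis hA : is_comodule_algebra R P.

Let bR : bilinear_map (amul R) := amul_bilinear (hopf_is_algebra hR).
Let bP : bilinear_map (amul P) := amul_bilinear (comodalg_is_algebra hA).
Let lP : lin (mlt P) := mlt_lin (comodalg_is_algebra hA).
Let lR : lin (mlt R) := mlt_lin (hopf_is_algebra hR).

Lemma coact_mlt (W : lmodType K) (F : A -> H -> W) (t : tensor A A) :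
  bilinear_map F ->
  \sw_(x, y <- coact (mlt P t)) F x y =
  \sw_(t0, t1 <- coact t) F (mlt P t0) (mlt R t1).
Proof.
move=> bF; move: t; apply: tensor_ext => // a b.
rewrite (mlt_pure _ _ (comodalg_is_algebra hA)) (coact_mul_sw hA) //.
rewrite coact_pure //; apply: eq_tlift => a0 a1; apply: eq_tlift => b0 b1.
by rewrite !mlt_pure //; [apply: hopf_is_algebra | apply: comodalg_is_algebra hA].
Qed.

(** The functional sits on the last leg of the product, hence stays with the
right factor of its coaction. *)
Lemma coact_mltr (g : HH -> K) (W : lmodType K) (F : A -> H -> W)
    (t : tensor A A) :
  linK g -> bilinear_map F ->
  \sw_(x, y <- coact (convr (mlt P) g t)) F x y =
  \sw_(t0, t1 <- coact t) F (mlt P t0) (convr (M := coreg HH) (mlt R) g t1).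
Proof.
move=> lg bF; rewrite /convr.
rewrite (lin_tlift_out (g := fun t => tlift F (coact t))) //.
under eq_tlift => t0 t1.
  rewrite (linZ (f := fun t => tlift F (coact t))) // coact_mlt // scale_sw.
  over.
rewrite sw_coact_assoc //; apply: eq_tlift => x c.
rewrite (lin_tlift_out (g := F _)) //; apply: eq_tlift => d e.
by rewrite (linZ (f := F _)).
Qed.

End ComoduleAlgebra.
End TwistedMul.

(** * The dual of the triple tensor product *)

Section ConvolutionInverses.
Variables (K : fieldType) (C : coalgType K).

(** Multiply [a b = c d] by [a'] on the left and [d'] on the right, or by [c'] on the
left and [b'] on the right. *)
Lemma conv_cancel (a a' b b' c c' d d' : C -> K) :
  linK a -> linK a' -> linK b -> linK b' ->
  linK c -> linK c' -> linK d -> linK d' ->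
  conv a' a = counit -> conv b b' = counit ->
  conv c' c = counit -> conv d d' = counit ->
  conv a b = conv c d ->
  [/\ conv a' c = conv b d' & conv c' a = conv d b'].
Proof.
move=> la la' lb lb' lc lc' ld ld' ea eb ec ed e.
have lab : linK (conv a b) by [].
split.
- rewrite -[LHS]convf1 // -ed convA // -[conv (conv a' c) d]convA // -e.
  by rewrite [conv a' (conv a b)]convA // ea conv1f.
- rewrite -[LHS]convf1 // -eb convA // -[conv (conv c' a) b]convA // e.
  by rewrite [conv c' (conv c d)]convA // ec conv1f.
Qed.

(** [b' a'] is a left inverse and [d' c'] a right inverse of the same element. *)
Lemma conv_inv_eq (a a' b b' c c' d d' : C -> K) :
  linK a -> linK a' -> linK b -> linK b' ->
  linK c -> linK c' -> linK d -> linK d' ->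
  conv a' a = counit -> conv b' b = counit ->
  conv c c' = counit -> conv d d' = counit ->
  conv a b = conv c d -> conv b' a' = conv d' c'.
Proof.
move=> la la' lb lb' lc lc' ld ld' ea eb ec ed e.
have eba : conv (conv b' a') (conv a b) = counit.
  by rewrite convA // -[conv (conv b' a') a]convA // ea convf1.
have ecd : conv (conv c d) (conv d' c') = counit.
  by rewrite -convA // [conv d _]convA // ed conv1f.
by rewrite -[LHS]convf1 // -ecd -e convA // eba conv1f.
Qed.

End ConvolutionInverses.

Section TripleFunctionals.
Variables (K : fieldType) (H : coalgType K).

Local Notation HH := (tensor_coalg H H).
Local Notation HHH := (tensor_coalg H HH).

Definition trilinK (T : H -> H -> H -> K) : Prop :=
  [/\ forall y z, linK (fun x => T x y z), forall x z, linK (fun y => T x y z)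
    & forall x y, linK (fun z => T x y z)].

Definition fun3 (T : H -> H -> H -> K) (p : HHH) : K :=
  tlift (fun (x : H) (q : tensor H H) => \sw_(y, z <- q) T x y z) p.

Lemma fun3_lin T : trilinK T -> linK (fun3 T).
Proof. by case=> T1 T2 T3; rewrite /fun3. Qed.

Lemma fun3_pure T x y z : trilinK T -> fun3 T (x ⊗ (y ⊗ z)) = T x y z.
Proof. by case=> T1 T2 T3; rewrite /fun3 !swEK. Qed.

Lemma fun3_ext (f g : HHH -> K) : linK f -> linK g ->
  (forall x y z, f (x ⊗ (y ⊗ z)) = g (x ⊗ (y ⊗ z))) -> f = g.
Proof.
move=> lf lg fg; apply: funext; apply: (@tensor_ext _ _ _ (Sc K)) => // x q.
by apply: (@tensor_ext _ _ _ (Sc K) (fun q => f (x ⊗ q)) (fun q => g (x ⊗ q))).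
Qed.

Lemma conv_fun3 T T' x y z : trilinK T -> trilinK T' ->
  conv (fun3 T) (fun3 T') (x ⊗ (y ⊗ z)) =
  \sw_(x1, x2 <- comul x) \sw_(y1, y2 <- comul y) \sw_(z1, z2 <- comul z)
    (T x1 y1 z1 * T' x2 y2 z2).
Proof.
move=> tT tT'; have lT := fun3_lin tT; have lT' := fun3_lin tT'.
rewrite /conv (@comul_pureK K H HH) //; apply: eq_tlift => x1 x2.
rewrite (@comul_pureK K H H) //; apply: eq_tlift => y1 y2.
by apply: eq_tlift => z1 z2; rewrite !fun3_pure.
Qed.

End TripleFunctionals.

(** * Cocycle identities *)

Section Cocycle.
Variables (K : fieldType) (H : coalgType K) (R : hopfOps H).
Variables (ga gb : {scalar (tensor H H)}).
Hypotheses (hR : is_hopf R) (hg : is_cocycle R ga gb).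

Local Notation HH := (tensor_coalg H H).
Local Notation HHH := (tensor_coalg H HH).
Local Notation "1H" := (aone R).
Local Notation "x ∙ y" := (amul R x y) (at level 40, left associativity).
Local Notation S := (antipode R).

Let bR : bilinear_map (amul R) := amul_bilinear (hopf_is_algebra hR).
Let lR : lin (mlt R) := mlt_lin (hopf_is_algebra hR).
Let lS : lin S := antipode_linear hR.
Let lga : @lin K HH (Sc K) ga. Proof. exact: linearP. Qed.
Let lgb : @lin K HH (Sc K) gb. Proof. exact: linearP. Qed.

Lemma conv_gagb : conv (C := HH) ga gb = counit.
Proof.
apply: funext; apply: (@tensor_ext _ _ _ (Sc K)) => // h k.
rewrite /conv (@comul_pureK K H H) // counit_pure.
by case: (cocycle_inv hg h k).
Qed.

Lemma conv_gbga : conv (C := HH) gb ga = counit.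
Proof.
apply: funext; apply: (@tensor_ext _ _ _ (Sc K)) => // h k.
rewrite /conv (@comul_pureK K H H) // counit_pure.
by case: (cocycle_inv hg h k).
Qed.

Lemma gb1r h : gb (h ⊗ 1H) = counit h.
Proof.
have := congr1 (fun f => f (h ⊗ 1H)) conv_gagb.
rewrite /conv (@comul_pureK K H H) // counit_pure (counit_one hR) mulr1 => <-.
under eq_tlift => h1 h2.
  rewrite (comul_one hR) swEK // (cocycle1r hg).
  over.
by rewrite (sw_counitlK (F := fun h : H => gb (h ⊗ 1H))).
Qed.

Lemma gb1l h : gb (1H ⊗ h) = counit h.
Proof.
have := congr1 (fun f => f (1H ⊗ h)) conv_gagb.
rewrite /conv (@comul_pureK K H H) // counit_pure (counit_one hR) mul1r => <-.
rewrite (comul_one hR) swEK //.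
under eq_tlift => h1 h2 do rewrite (cocycle1l hg).
by rewrite (sw_counitlK (F := fun h : H => gb (1H ⊗ h))).
Qed.

(** The four elements of the dual of [H ⊗ (H ⊗ H)] that a functional on [H ⊗ H]
gives by pullback along the coalgebra maps that send [x ⊗ (y ⊗ z)]
to [x ⊗ y ε(z)], [x y ⊗ z], [ε(x) y ⊗ z] and [x ⊗ y z].  Pullback preserves
convolution inverses, and the cocycle condition is an equation between products
of these elements. *)
Definition left_outer (f : HH -> K) : HHH -> K :=
  fun3 (fun x y z : H => counit z * f (x ⊗ y)).
Definition left_inner (f : HH -> K) : HHH -> K :=
  fun3 (fun x y z : H => f ((x ∙ y) ⊗ z)).
Definition right_outer (f : HH -> K) : HHH -> K :=
  fun3 (fun x y z : H => counit x * f (y ⊗ z)).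
Definition right_inner (f : HH -> K) : HHH -> K :=
  fun3 (fun x y z : H => f (x ⊗ (y ∙ z))).

Section Functional.
Variables (f g : HH -> K).
Hypotheses (lf : linK f) (lg : linK g).

Let tri_left_outer (k : HH -> K) : linK k ->
  trilinK (fun x y z : H => counit z * k (x ⊗ y)).
Proof. by []. Qed.
Let tri_left_inner (k : HH -> K) : linK k ->
  trilinK (fun x y z : H => k ((x ∙ y) ⊗ z)).
Proof. by []. Qed.
Let tri_right_outer (k : HH -> K) : linK k ->
  trilinK (fun x y z : H => counit x * k (y ⊗ z)).
Proof. by []. Qed.
Let tri_right_inner (k : HH -> K) : linK k ->
  trilinK (fun x y z : H => k (x ⊗ (y ∙ z))).
Proof. by []. Qed.

Hypothesis fg : conv f g = counit.

Let fgE x y : \sw_(x1, x2 <- comul x) \sw_(y1, y2 <- comul y)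
  (f (x1 ⊗ y1) * g (x2 ⊗ y2)) = counit x * counit y.
Proof. by rewrite -counit_pure -fg /conv (@comul_pureK K H H). Qed.

Lemma left_outer_inv : conv (left_outer f) (left_outer g) = counit.
Proof.
rewrite /left_outer; apply: fun3_ext => // [|x y z].
  by apply: conv_linK; apply: fun3_lin; apply: tri_left_outer.
rewrite conv_fun3; [|exact: tri_left_outer..].
rewrite (@counit_pure _ H HH) counit_pure mulrA -fgE mulrC mulr_sw.
apply: eq_tlift => x1 x2; rewrite mulr_sw; apply: eq_tlift => y1 y2.
under eq_tlift => z1 z2 do rewrite -mulrA.
by rewrite (sw_counitlK (F := fun z => f _ * (counit z * g _))) // mulrCA.
Qed.

Lemma right_outer_inv : conv (right_outer f) (right_outer g) = counit.
Proof.
rewrite /right_outer; apply: fun3_ext => // [|x y z].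
  by apply: conv_linK; apply: fun3_lin; apply: tri_right_outer.
rewrite conv_fun3; [|exact: tri_right_outer..].
rewrite (@counit_pure _ H HH) counit_pure -fgE.
rewrite -(sw_counitlK (F := fun x => counit x *
  \sw_(y1, y2 <- comul y) \sw_(z1, z2 <- comul z) (f (y1 ⊗ z1) * g (y2 ⊗ z2)))) //.
apply: eq_tlift => x1 x2; rewrite !mulr_sw; apply: eq_tlift => y1 y2.
rewrite !mulr_sw; apply: eq_tlift => z1 z2.
by rewrite -mulrA [in RHS](mulrCA (counit x2)).
Qed.

Lemma left_inner_inv : conv (left_inner f) (left_inner g) = counit.
Proof.
rewrite /left_inner; apply: fun3_ext => // [|x y z].
  by apply: conv_linK; apply: fun3_lin; apply: tri_left_inner.
rewrite conv_fun3; [|exact: tri_left_inner..].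
rewrite (@counit_pure _ H HH) counit_pure mulrA -(counit_mul hR) -fgE.
by rewrite (@comul_mul_sw _ _ _ hR (Sc K)).
Qed.

Lemma right_inner_inv : conv (right_inner f) (right_inner g) = counit.
Proof.
rewrite /right_inner; apply: fun3_ext => // [|x y z].
  by apply: conv_linK; apply: fun3_lin; apply: tri_right_inner.
rewrite conv_fun3; [|exact: tri_right_inner..].
rewrite (@counit_pure _ H HH) counit_pure -(counit_mul hR) -fgE.
apply: eq_tlift => x1 x2.
by rewrite (@comul_mul_sw _ _ _ hR (Sc K)).
Qed.

End Functional.

Section Products.
Variables (f g : HH -> K).
Hypotheses (lf : linK f) (lg : linK g).

Lemma left_outer_inner x y z :
  conv (left_outer f) (left_inner g) (x ⊗ (y ⊗ z)) =
  \sw_(x1, x2 <- comul x) \sw_(y1, y2 <- comul y) (f (x1 ⊗ y1) * g ((x2 ∙ y2) ⊗ z)).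
Proof.
rewrite conv_fun3 //; apply: eq_tlift => x1 x2; apply: eq_tlift => y1 y2.
under eq_tlift => z1 z2 do rewrite -mulrA.
by rewrite (sw_counitlK (F := fun z : H => f (x1 ⊗ y1) * g ((x2 ∙ y2) ⊗ z))).
Qed.

Lemma right_outer_inner x y z :
  conv (right_outer f) (right_inner g) (x ⊗ (y ⊗ z)) =
  \sw_(y1, y2 <- comul y) \sw_(z1, z2 <- comul z) (f (y1 ⊗ z1) * g (x ⊗ (y2 ∙ z2))).
Proof.
rewrite conv_fun3 // tlift_exch; apply: eq_tlift => y1 y2.
rewrite tlift_exch; apply: eq_tlift => z1 z2.
under eq_tlift => x1 x2 do rewrite -mulrA.
by rewrite (sw_counitlK (F := fun x : H => f (y1 ⊗ z1) * g (x ⊗ (y2 ∙ z2)))).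
Qed.

Lemma left_inner_outer x y z :
  conv (left_inner f) (left_outer g) (x ⊗ (y ⊗ z)) =
  \sw_(x1, x2 <- comul x) \sw_(y1, y2 <- comul y) (f ((x1 ∙ y1) ⊗ z) * g (x2 ⊗ y2)).
Proof.
rewrite conv_fun3 //; apply: eq_tlift => x1 x2; apply: eq_tlift => y1 y2.
under eq_tlift => z1 z2 do rewrite mulrCA.
by rewrite (sw_counitrK (F := fun z : H => f ((x1 ∙ y1) ⊗ z) * g (x2 ⊗ y2))).
Qed.

Lemma right_inner_outer x y z :
  conv (right_inner f) (right_outer g) (x ⊗ (y ⊗ z)) =
  \sw_(y1, y2 <- comul y) \sw_(z1, z2 <- comul z) (f (x ⊗ (y1 ∙ z1)) * g (y2 ⊗ z2)).
Proof.
rewrite conv_fun3 // tlift_exch; apply: eq_tlift => y1 y2.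
rewrite tlift_exch; apply: eq_tlift => z1 z2.
under eq_tlift => x1 x2 do rewrite mulrCA.
by rewrite (sw_counitrK (F := fun x : H => f (x ⊗ (y1 ∙ z1)) * g (y2 ⊗ z2))).
Qed.

Lemma left_right_outer x y z :
  conv (left_outer f) (right_outer g) (x ⊗ (y ⊗ z)) =
  \sw_(y1, y2 <- comul y) (f (x ⊗ y1) * g (y2 ⊗ z)).
Proof.
rewrite conv_fun3 // tlift_exch; apply: eq_tlift => y1 y2.
under eq_tlift => x1 x2.
  under eq_tlift => z1 z2 do rewrite -mulrA.
  rewrite (sw_counitlK (F := fun z : H => f (x1 ⊗ y1) * (counit x2 * g (y2 ⊗ z)))) //
    mulrCA.
  over.
by rewrite (sw_counitrK (F := fun x : H => f (x ⊗ y1) * g (y2 ⊗ z))).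
Qed.

Lemma right_left_outer x y z :
  conv (right_outer f) (left_outer g) (x ⊗ (y ⊗ z)) =
  \sw_(y1, y2 <- comul y) (f (y1 ⊗ z) * g (x ⊗ y2)).
Proof.
rewrite conv_fun3 // tlift_exch; apply: eq_tlift => y1 y2.
under eq_tlift => x1 x2.
  under eq_tlift => z1 z2 do rewrite mulrCA.
  rewrite (sw_counitrK (F := fun z : H => (counit x1 * f (y1 ⊗ z)) * g (x2 ⊗ y2))) //
    -mulrA.
  over.
by rewrite (sw_counitlK (F := fun x : H => f (y1 ⊗ z) * g (x ⊗ y2))).
Qed.

End Products.

Lemma cocycle_conv :
  conv (left_outer ga) (left_inner ga) = conv (right_outer ga) (right_inner ga).
Proof.
apply: fun3_ext => [||x y z]; try by apply: conv_linK; apply: fun3_lin.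
by rewrite left_outer_inner // right_outer_inner // (cocycleP hg).
Qed.

Lemma inverse_cocycle x y z :
  \sw_(x1, x2 <- comul x) \sw_(y1, y2 <- comul y)
    (gb ((x1 ∙ y1) ⊗ z) * gb (x2 ⊗ y2)) =
  \sw_(y1, y2 <- comul y) \sw_(z1, z2 <- comul z)
    (gb (x ⊗ (y1 ∙ z1)) * gb (y2 ⊗ z2)).
Proof.
rewrite -left_inner_outer // -right_inner_outer //.
congr ((_ : HHH -> K) _); apply: conv_inv_eq cocycle_conv; try exact: fun3_lin.
- by apply: left_outer_inv => //; apply: conv_gbga.
- by apply: left_inner_inv => //; apply: conv_gbga.
- by apply: right_outer_inv => //; apply: conv_gagb.
- by apply: right_inner_inv => //; apply: conv_gagb.
Qed.

Lemma cocycle_cancel x y z :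
  \sw_(y1, y2 <- comul y) (gb (x ⊗ y1) * ga (y2 ⊗ z)) =
    \sw_(x1, x2 <- comul x) \sw_(y1, y2 <- comul y) \sw_(z1, z2 <- comul z)
      (ga ((x1 ∙ y1) ⊗ z1) * gb (x2 ⊗ (y2 ∙ z2))) /\
  \sw_(y1, y2 <- comul y) (gb (y1 ⊗ z) * ga (x ⊗ y2)) =
    \sw_(x1, x2 <- comul x) \sw_(y1, y2 <- comul y) \sw_(z1, z2 <- comul z)
      (ga (x1 ⊗ (y1 ∙ z1)) * gb ((x2 ∙ y2) ⊗ z2)).
Proof.
rewrite -left_right_outer // -right_left_outer //.
have [||||||||||||-> ->] := @conv_cancel _ HHH _ (left_outer gb) _ (left_inner gb)
  _ (right_outer gb) _ (right_inner gb) _ _ _ _ _ _ _ _ _ _ _ _ cocycle_conv;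
  try exact: fun3_lin.
- by apply: left_outer_inv => //; apply: conv_gbga.
- by apply: left_inner_inv => //; apply: conv_gagb.
- by apply: right_outer_inv => //; apply: conv_gbga.
- by apply: right_inner_inv => //; apply: conv_gagb.
by rewrite !conv_fun3.
Qed.

End Cocycle.

(** * The functionals u and ū *)

Section TwistedHopf.
Variables (K : fieldType) (H : coalgType K) (R : hopfOps H).
Variables (ga gb : {scalar (tensor H H)}).
Hypotheses (hR : is_hopf R) (hg : is_cocycle R ga gb).

Local Notation HH := (tensor_coalg H H).
Local Notation "1H" := (aone R).
Local Notation "x ∙ y" := (amul R x y) (at level 40, left associativity).
Local Notation S := (antipode R).
Local Notation u := (twist_u R ga).
Local Notation ub := (twist_ub R gb).

Let bR : bilinear_map (amul R) := amul_bilinear (hopf_is_algebra hR).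
Let lR : lin (mlt R) := mlt_lin (hopf_is_algebra hR).
Let lS : lin S := antipode_linear hR.
Let lga : @lin K HH (Sc K) ga. Proof. exact: linearP. Qed.
Let lgb : @lin K HH (Sc K) gb. Proof. exact: linearP. Qed.

Lemma twist_u_lin : linK u. Proof. by rewrite /twist_u. Qed.
Lemma twist_ub_lin : linK ub. Proof. by rewrite /twist_ub. Qed.
Let lu := twist_u_lin.
Let lub := twist_ub_lin.

(** The first identity of [cocycle_cancel] at [S h_1 ⊗ h_2 ⊗ S h_3]: its left side
is [ū * u], and on the right [S h_1 h_2] and [h_2 S h_3] cancel, which leaves
values of the normalized [γ] and [γ̄] at the unit. *)
Lemma conv_ub_u : conv ub u = counit.
Proof.
apply: funext => h; rewrite /conv /twist_ub /twist_u.
under eq_tlift => x y.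
  rewrite sw_mulr.
  under eq_tlift => a b do rewrite mulr_sw.
  over.
rewrite (@sw_regroup4 _ _ (Sc K)) //=.
under eq_tlift => p z.
  under eq_tlift => x s do rewrite (cocycle_cancel hR hg _ _ _).1.
  over.
rewrite -(@sw_assoc _ _ (Sc K)) //=.
under eq_tlift => k s.
  rewrite (@collapse_antipodel _ _ _ hR (Sc K) (fun w x y =>
    \sw_(z1, z2 <- comul (S s)) (ga (w ⊗ z1) * gb (x ⊗ (y ∙ z2))))) //=.
  under eq_tlift => p x.
    under eq_tlift => z1 z2 do rewrite (cocycle1l hg).
    rewrite (sw_counitlK (F := fun z : H => gb (S p ⊗ (x ∙ z)))) //.
    over.
  over.
rewrite (@sw_assoc _ _ (Sc K) (fun p x s => gb (S p ⊗ (x ∙ S s)))) //=.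
under eq_tlift => p z.
  rewrite -(@lin_tlift_out _ _ _ _ _ _ _ (Sc K) (fun x => gb (S p ⊗ x))) //.
  rewrite (antipoder hR) (@linZ _ _ (Sc K) (fun x => gb (S p ⊗ x))) //.
  rewrite (gb1r hR hg) (counit_antipode hR).
  over.
exact: sw_counitrK.
Qed.

(** The second identity of [cocycle_cancel] at [h_1 ⊗ S h_2 ⊗ h_3]. *)
Lemma conv_u_ub : conv u ub = counit.
Proof.
apply: funext => h; rewrite /conv /twist_ub /twist_u.
under eq_tlift => x y.
  rewrite sw_mulr.
  under eq_tlift => a b do (rewrite mulr_sw; under eq_tlift => c d do rewrite mulrC).
  over.
rewrite (@sw_regroup4 _ _ (Sc K)) //=.
under eq_tlift => p z.
  under eq_tlift => x s.
    rewrite -(@comul_antipode_sw _ _ _ hR (Sc K) (fun y1 y2 => gb (y1 ⊗ s) * ga (p ⊗ y2))) //=.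
    rewrite (cocycle_cancel hR hg _ _ _).2 tlift_exch.
    under eq_tlift => y1 y2 do rewrite tlift_exch.
    over.
  rewrite (@collapse_antipodel _ _ _ hR (Sc K) (fun w y z =>
    \sw_(x1, x2 <- comul p) (ga (x1 ⊗ w) * gb ((x2 ∙ y) ⊗ z)))) //=.
  under eq_tlift => y s.
    under eq_tlift => x1 x2 do rewrite (cocycle1r hg).
    rewrite (sw_counitlK (F := fun x : H => gb ((x ∙ S y) ⊗ s))) //.
    over.
  over.
rewrite -(@sw_assoc _ _ (Sc K) (fun p x s => gb ((p ∙ S x) ⊗ s))) //=.
under eq_tlift => p z.
  rewrite -(@lin_tlift_out _ _ _ _ _ _ _ (Sc K) (fun x => gb (x ⊗ z))) //.
  rewrite (antipoder hR) (@linZ _ _ (Sc K) (fun x => gb (x ⊗ z))) //.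
  rewrite (gb1l hR hg).
  over.
exact: sw_counitlK.
Qed.

(** Since [S] reverses the coproduct, [ū(h_2) γ(S h_1 ⊗ h_3)] is the convolution
[γ̄ * γ] evaluated at [S h_1 ⊗ h_2]. *)
Lemma ub_ga_cancel h :
  \sw_(h1, k <- comul h) \sw_(h2, h3 <- comul k) (ub h2 * ga (S h1 ⊗ h3)) = counit h.
Proof.
transitivity (\sw_(h1, h2 <- comul h) conv (C := HH) gb ga (S h1 ⊗ h2)); last first.
  rewrite (conv_gbga hg).
  under eq_tlift => h1 h2 do rewrite counit_pure (counit_antipode hR).
  exact: sw_counitlK.
rewrite /conv; under [RHS]eq_tlift => h1 h2.
  rewrite (@comul_pureK K H H) // (@comul_antipode_sw _ _ _ hR (Sc K)) //=.
  over.
rewrite (@sw_regroup4 _ _ (Sc K)) //=.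
apply: eq_tlift => h1 k; apply: eq_tlift => h2 h3.
by rewrite /twist_ub sw_mulr.
Qed.

(** Likewise [γ̄ * γ] evaluated at [h_1 ⊗ S h_2]. *)
Lemma u_gb_cancel h :
  \sw_(h1, k <- comul h) \sw_(h2, h3 <- comul k) (u h2 * gb (h1 ⊗ S h3)) = counit h.
Proof.
transitivity (\sw_(h1, h2 <- comul h) conv (C := HH) gb ga (h1 ⊗ S h2)); last first.
  rewrite (conv_gbga hg).
  under eq_tlift => h1 h2 do rewrite counit_pure (counit_antipode hR).
  exact: sw_counitlK.
rewrite /conv; under [RHS]eq_tlift => h1 h2.
  rewrite (@comul_pureK K H H) //.
  under eq_tlift => p q do rewrite (@comul_antipode_sw _ _ _ hR (Sc K)) //=.
  over.
rewrite (@sw_regroup4 _ _ (Sc K)) //=.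
apply: eq_tlift => h1 k; apply: eq_tlift => h2 h3.
by rewrite /twist_u sw_mulr; apply: eq_tlift => a b; rewrite mulrC.
Qed.

End TwistedHopf.

(** * The twisted Hopf algebra *)

Section TwistIsHopf.
Variables (K : fieldType) (H : coalgType K) (R : hopfOps H).
Variables (ga gb : {scalar (tensor H H)}).
Hypotheses (hR : is_hopf R) (hg : is_cocycle R ga gb).

Local Notation HH := (tensor_coalg H H).
Local Notation "1H" := (aone R).
Local Notation "x ∙ y" := (amul R x y) (at level 40, left associativity).
Local Notation S := (antipode R).
Local Notation u := (twist_u R ga).
Local Notation ub := (twist_ub R gb).

Let bR : bilinear_map (amul R) := amul_bilinear (hopf_is_algebra hR).
Let lR : lin (mlt R) := mlt_lin (hopf_is_algebra hR).
Let lS : lin S := antipode_linear hR.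
Let lga : @lin K HH (Sc K) ga. Proof. exact: linearP. Qed.
Let lgb : @lin K HH (Sc K) gb. Proof. exact: linearP. Qed.
Let lu := twist_u_lin ga hR.
Let lub := twist_ub_lin gb hR.

(** The one-sided twists [γ * m] and [m * γ̄], and the two-sided one. *)
Definition mulL : HH -> H := convl ga (mlt R).
Definition mulR : HH -> H := convr (M := coreg HH) (mlt R) gb.
Definition mulT : HH -> H := convl ga mulR.

Lemma mulL_lin : lin mulL. Proof. exact: convl_lin. Qed.
Lemma mulR_lin : lin mulR. Proof. exact: (convr_lin (M := coreg HH)). Qed.
Let lL := mulL_lin.
Let lRr := mulR_lin.
Lemma mulT_lin : lin mulT. Proof. exact: convl_lin. Qed.
Let lT := mulT_lin.

Lemma mulTE : mulT = convr (M := coreg HH) mulL gb.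
Proof. by rewrite /mulT /mulR convl_convr. Qed.

Lemma convl_gb_mulT : convl gb mulT = mulR.
Proof. by rewrite /mulT convlA // (conv_gbga hg) convl1. Qed.

Lemma mulL_pure x y :
  mulL (x ⊗ y) = \sw_(x1, x2 <- comul x) \sw_(y1, y2 <- comul y)
    ga (x1 ⊗ y1) *: (x2 ∙ y2).
Proof.
rewrite /mulL /convl (@comul_pure K H H) //.
apply: eq_tlift => x1 x2; apply: eq_tlift => y1 y2.
by rewrite (mlt_pure _ _ (hopf_is_algebra hR)).
Qed.

Lemma mulR_pure x y :
  mulR (x ⊗ y) = \sw_(x1, x2 <- comul x) \sw_(y1, y2 <- comul y)
    gb (x2 ⊗ y2) *: (x1 ∙ y1).
Proof.
rewrite /mulR /convr [LHS](@comul_pure K H H) //.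
apply: eq_tlift => x1 x2; apply: eq_tlift => y1 y2.
by rewrite (mlt_pure _ _ (hopf_is_algebra hR)).
Qed.

Lemma comul3_pure (W : lmodType K) (G : HH -> HH -> HH -> W) h k :
  (forall y z, lin (fun x => G x y z)) -> (forall x z, lin (fun y => G x y z)) ->
  (forall x y, lin (fun z => G x y z)) ->
  \sw_(t1, t' <- comul (h ⊗ k)) \sw_(t2, t3 <- comul t') G t1 t2 t3 =
  \sw_(h1, h' <- comul h) \sw_(h2, h3 <- comul h')
  \sw_(k1, k' <- comul k) \sw_(k2, k3 <- comul k')
    G (h1 ⊗ k1) (h2 ⊗ k2) (h3 ⊗ k3).
Proof.
move=> G1 G2 G3; rewrite (@comul_pure K H H) //; apply: eq_tlift => h1 h'.
under eq_tlift => k1 k' do rewrite (@comul_pure K H H) //.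
by rewrite tlift_exch.
Qed.

Lemma twist_mulE h k : twist_mul R ga gb h k = mulT (h ⊗ k).
Proof.
rewrite /mulT /mulR /convl /convr.
under [RHS]eq_tlift => t1 t' do rewrite scale_sw.
rewrite (@comul3_pure _ (fun t1 t2 t3 => ga t1 *: (gb t3 *: mlt R t2))) //.
do 4!apply: eq_tlift => ? ?.
by rewrite scalerA (mlt_pure _ _ (hopf_is_algebra hR)).
Qed.

Lemma twist_mul_bilinear : bilinear_map (twist_mul R ga gb).
Proof.
have -> : twist_mul R ga gb = fun h k => mulT (h ⊗ k).
  by apply: funext => h; apply: funext => k; apply: twist_mulE.
by [].
Qed.

Lemma comul_mulR (W : lmodType K) (F : H -> H -> W) t :
  bilinear_map F ->
  \sw_(x, y <- comul (mulR t)) F x y =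
  \sw_(t1, t2 <- comul t) F (mlt R t1) (mulR t2).
Proof. exact: (coact_mltr hR (hopf_comodule_algebra hR)). Qed.

(** [γ] stays with the first leg of the product and [γ̄] with the last, so only
the one-sided twists appear. *)
Lemma comul_mulT (W : lmodType K) (F : H -> H -> W) t :
  bilinear_map F ->
  \sw_(x, y <- comul (mulT t)) F x y =
  \sw_(t1, t2 <- comul t) F (mulL t1) (mulR t2).
Proof.
move=> bF; rewrite /mulT /convl.
rewrite (lin_tlift_out (g := fun t => tlift F (comul t))) //.
under eq_tlift => t0 t1.
  rewrite (linZ (f := fun t => tlift F (comul t))) // comul_mulR // scale_sw.
  over.
rewrite -sw_assoc //; apply: eq_tlift => x c.
rewrite /mulL /convl (lin_tlift_out (g := fun x => F x _)) //.
by apply: eq_tlift => d e; rewrite (linZ (f := fun x => F x _)).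
Qed.

Lemma comul3_mulT (W : lmodType K) (G : H -> H -> H -> W) t :
  (forall y z, lin (fun x => G x y z)) -> (forall x z, lin (fun y => G x y z)) ->
  (forall x y, lin (fun z => G x y z)) ->
  \sw_(x1, x' <- comul (mulT t)) \sw_(x2, x3 <- comul x') G x1 x2 x3 =
  \sw_(t1, t' <- comul t) \sw_(t2, t3 <- comul t') G (mulL t1) (mlt R t2) (mulR t3).
Proof.
move=> G1 G2 G3; rewrite comul_mulT //; apply: eq_tlift => t1 t'.
by rewrite comul_mulR.
Qed.

Lemma cocycle_mulL x y z : ga (mulL (x ⊗ y) ⊗ z) = ga (x ⊗ mulL (y ⊗ z)).
Proof.
rewrite !mulL_pure.
rewrite (@lin_tlift_out _ _ _ _ _ _ _ (Sc K) (fun x => ga (x ⊗ z))) //.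
rewrite (@lin_tlift_out _ _ _ _ _ _ _ (Sc K) (fun z => ga (x ⊗ z))) //.
etransitivity; [|etransitivity; [exact: (cocycleP hg x y z)|]].
  apply: eq_tlift => x1 x2.
  rewrite (@lin_tlift_out _ _ _ _ _ _ _ (Sc K) (fun x => ga (x ⊗ z))) //.
  by apply: eq_tlift => y1 y2; rewrite (@linZ _ _ (Sc K) (fun x => ga (x ⊗ z))).
symmetry; apply: eq_tlift => x1 x2.
rewrite (@lin_tlift_out _ _ _ _ _ _ _ (Sc K) (fun z => ga (x ⊗ z))) //.
by apply: eq_tlift => y1 y2; rewrite (@linZ _ _ (Sc K) (fun z => ga (x ⊗ z))).
Qed.

Lemma cocycle_mulR x y z : gb (mulR (x ⊗ y) ⊗ z) = gb (x ⊗ mulR (y ⊗ z)).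
Proof.
rewrite !mulR_pure.
rewrite (@lin_tlift_out _ _ _ _ _ _ _ (Sc K) (fun x => gb (x ⊗ z))) //.
rewrite (@lin_tlift_out _ _ _ _ _ _ _ (Sc K) (fun z => gb (x ⊗ z))) //.
etransitivity; [|etransitivity; [exact: (inverse_cocycle hR hg x y z)|]].
  apply: eq_tlift => x1 x2.
  rewrite (@lin_tlift_out _ _ _ _ _ _ _ (Sc K) (fun x => gb (x ⊗ z))) //.
  apply: eq_tlift => y1 y2; rewrite (@linZ _ _ (Sc K) (fun x => gb (x ⊗ z))) //.
  exact: mulrC.
symmetry; apply: eq_tlift => x1 x2.
rewrite (@lin_tlift_out _ _ _ _ _ _ _ (Sc K) (fun z => gb (x ⊗ z))) //.
apply: eq_tlift => y1 y2; rewrite (@linZ _ _ (Sc K) (fun z => gb (x ⊗ z))) //.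
exact: mulrC.
Qed.

(** After expanding the twofold coproduct of the inner product, both bracketings
differ only in the arguments of [γ] and of [γ̄]. *)
Lemma twist_mulA : associative (twist_mul R ga gb).
Proof.
move=> x y z.
transitivity (
  \sw_(x1, x' <- comul x) \sw_(x2, x3 <- comul x')
  \sw_(y1, y' <- comul y) \sw_(y2, y3 <- comul y')
  \sw_(z1, z' <- comul z) \sw_(z2, z3 <- comul z')
    (ga (x1 ⊗ mulL (y1 ⊗ z1)) * gb (x3 ⊗ mulR (y3 ⊗ z3))) *: (x2 ∙ (y2 ∙ z2))).
  rewrite /twist_mul -/(twist_mul R ga gb y z) twist_mulE.
  apply: eq_tlift => x1 x'; apply: eq_tlift => x2 x3.
  rewrite (@comul3_mulT _ (fun p q r => (ga (x1 ⊗ p) * gb (x3 ⊗ r)) *: (x2 ∙ q))) //.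
  rewrite (@comul3_pure _ (fun p q r =>
    (ga (x1 ⊗ mulL p) * gb (x3 ⊗ mulR r)) *: (x2 ∙ mlt R q))) //.
  by do 4!apply: eq_tlift => ? ?; rewrite (mlt_pure _ _ (hopf_is_algebra hR)).
transitivity (
  \sw_(x1, x' <- comul x) \sw_(x2, x3 <- comul x')
  \sw_(y1, y' <- comul y) \sw_(y2, y3 <- comul y')
  \sw_(z1, z' <- comul z) \sw_(z2, z3 <- comul z')
    (ga (mulL (x1 ⊗ y1) ⊗ z1) * gb (mulR (x3 ⊗ y3) ⊗ z3)) *: (x2 ∙ y2 ∙ z2)).
  do 6!apply: eq_tlift => ? ?.
  by rewrite cocycle_mulL cocycle_mulR (amulA (hopf_is_algebra hR)).
rewrite /twist_mul -/(twist_mul R ga gb x y) twist_mulE.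
rewrite (@comul3_mulT _ (fun p q r =>
  \sw_(z1, z' <- comul z) \sw_(z2, z3 <- comul z')
    (ga (p ⊗ z1) * gb (r ⊗ z3)) *: (q ∙ z2))) //.
rewrite (@comul3_pure _ (fun p q r =>
  \sw_(z1, z' <- comul z) \sw_(z2, z3 <- comul z')
    (ga (mulL p ⊗ z1) * gb (mulR r ⊗ z3)) *: (mlt R q ∙ z2))) //.
by do 6!apply: eq_tlift => ? ?; rewrite (mlt_pure _ _ (hopf_is_algebra hR)).
Qed.

Lemma mulL1l h : mulL (1H ⊗ h) = h.
Proof.
rewrite mulL_pure (comul_one hR) swE //.
under eq_tlift => x y do rewrite (cocycle1l hg) (amul1l (hopf_is_algebra hR)).
exact: counitl.
Qed.

Lemma mulL1r h : mulL (h ⊗ 1H) = h.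
Proof.
rewrite mulL_pure.
under eq_tlift => x y.
  rewrite (comul_one hR) swE // (cocycle1r hg) (amul1r (hopf_is_algebra hR)).
  over.
exact: counitl.
Qed.

Lemma twist_mul1l : left_id 1H (twist_mul R ga gb).
Proof.
move=> h; rewrite twist_mulE mulTE /convr [LHS](@comul_pure K H H) //.
rewrite (comul_one hR) swE //.
under eq_tlift => x y do rewrite mulL1l (gb1l hR hg).
exact: counitr.
Qed.

Lemma twist_mul1r : right_id 1H (twist_mul R ga gb).
Proof.
move=> h; rewrite twist_mulE mulTE /convr [LHS](@comul_pure K H H) //.
under eq_tlift => x y.
  rewrite (comul_one hR) swE // mulL1r (gb1r hR hg).
  over.
exact: counitr.
Qed.

Lemma twist_is_algebra : is_algebra (AlgOps (twist_mul R ga gb) 1H).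
Proof.
split; [exact: twist_mul_bilinear | exact: twist_mulA | exact: twist_mul1l |].
exact: twist_mul1r.
Qed.

Lemma comul_twist_mul h k :
  comul (twist_mul R ga gb h k) =
  tmul (AlgOps (twist_mul R ga gb) 1H) (AlgOps (twist_mul R ga gb) 1H)
    (comul h) (comul k).
Proof.
rewrite twist_mulE -[LHS]sw_pure comul_mulT //.
rewrite -convl_gb_mulT.
rewrite -[LHS](@convr_balance K HH (coreg HH) _ _ _ mulL mulT) // -mulTE.
rewrite [LHS](@comul_pure K H H) // /tmul.
apply: eq_tlift => x1 x2; apply: eq_tlift => y1 y2.
by rewrite /= !twist_mulE.
Qed.

Lemma counit_twist_mul h k : counit (twist_mul R ga gb h k) = counit h * counit k.
Proof.
have e t : counit (mlt R t) = counit t :> K.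
  move: t; apply: (@tensor_ext _ _ _ (Sc K)) => // x y.
  by rewrite (mlt_pure _ _ (hopf_is_algebra hR)) (counit_mul hR) counit_pure.
rewrite twist_mulE -counit_pure -(conv_gagb hg) /mulT /convl /conv.
rewrite (@lin_tlift_out K _ _ _ _ _ H (Sc K) counit) //.
apply: eq_tlift => t1 t2; rewrite linearZ /=; congr (_ * _).
rewrite /mulR /convr (@lin_tlift_out K _ _ _ _ _ H (Sc K) counit) //.
rewrite -[RHS](sw_counitlK (F := gb : HH -> K)) //.
by apply: eq_tlift => x y; rewrite linearZ /= e mulrC.
Qed.

(** In [γ̄(S h_1 ⊗ h_4) S(h_2) h_3] the inner legs cancel. *)
Lemma mulR_antipode h :
  \sw_(h1, h2 <- comul h) mulR (S h1 ⊗ h2) = ub h *: 1H.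
Proof.
under eq_tlift => h1 h2 do rewrite mulR_pure.
rewrite (@collapse_antipodel _ _ _ hR _ (fun w x y => gb (x ⊗ y) *: w)) //.
by rewrite -sw_scale.
Qed.

Lemma mulL_antipode h :
  \sw_(h1, h2 <- comul h) mulL (h1 ⊗ S h2) = u h *: 1H.
Proof.
under eq_tlift => h1 h2 do rewrite mulL_pure.
rewrite (@collapse_antipoder _ _ _ hR _ (fun x y w => ga (x ⊗ y) *: w)) //.
by rewrite -sw_scale.
Qed.

(** The factor [ū] cancels the [γ] on the first legs by [ub_ga_cancel], which
leaves the product twisted on the right only, and [mulR_antipode] applies. *)
Lemma twist_mul_antipode_l h :
  \sw_(h1, k <- comul h) \sw_(h2, h3 <- comul k)
    ub h2 *: twist_mul R ga gb (S h1) h3 = ub h *: 1H.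
Proof.
under eq_tlift => h1 k.
  under eq_tlift => h2 h3.
    rewrite twist_mulE /mulT /convl (@comul_pure K H H) //.
    rewrite (@comul_antipode_sw _ _ _ hR) //= scale_sw.
    under eq_tlift => x y do rewrite scale_sw.
    over.
  over.
rewrite sw_regroup5 //= -mulR_antipode.
under eq_tlift => p z.
  under eq_tlift => x t.
    under eq_tlift => q y.
      under eq_tlift => r s do rewrite scalerA.
      rewrite -sw_scale.
      over.
    rewrite -sw_scale (ub_ga_cancel hR hg).
    over.
  rewrite (sw_counitl (F := fun t : H => mulR (S p ⊗ t))) //.
  over.
by [].
Qed.

Lemma twist_mul_antipode_r h :
  \sw_(h1, k <- comul h) \sw_(h2, h3 <- comul k)
    u h2 *: twist_mul R ga gb h1 (S h3) = u h *: 1H.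
Proof.
under eq_tlift => h1 k.
  under eq_tlift => h2 h3.
    rewrite twist_mulE mulTE /convr [X in _ *: X](@comul_pure K H H) // scale_sw.
    under eq_tlift => x y do rewrite (@comul_antipode_sw _ _ _ hR) //= scale_sw.
    over.
  over.
rewrite sw_regroup5 //= -mulL_antipode.
under eq_tlift => p z.
  under eq_tlift => x t.
    under eq_tlift => q y.
      under eq_tlift => r s do rewrite scalerA.
      rewrite -sw_scale.
      over.
    rewrite -sw_scale (u_gb_cancel hR hg).
    over.
  rewrite (sw_counitl (F := fun t : H => mulL (p ⊗ S t))) //.
  over.
by [].
Qed.

Lemma twist_is_hopf : is_hopf (twist_hopf R ga gb).
Proof.
have bT := twist_mul_bilinear.
split=> /=.
- exact: twist_is_algebra.
- exact: comul_one hR.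
- exact: comul_twist_mul.
- exact: counit_one hR.
- exact: counit_twist_mul.
- by change (lin (twist_antipode R ga gb)); rewrite /twist_antipode.
- move=> h; rewrite -(conv_u_ub hR hg) /conv /twist_antipode sw_scale.
  under eq_tlift => h1 h2.
    rewrite (lin_tlift_out (g := fun x => twist_mul R ga gb x h2)) //.
    under eq_tlift => a h'.
      rewrite (lin_tlift_out (g := fun x => twist_mul R ga gb x h2)) //.
      under eq_tlift => b c.
        rewrite (linZ (f := fun x => twist_mul R ga gb x h2)) //.
        over.
      over.
    over.
  rewrite sw_assoc //; apply: eq_tlift => a k.
  rewrite sw_assoc // -scalerA -twist_mul_antipode_l scale_sw.
  apply: eq_tlift => b z; rewrite scale_sw.
  by apply: eq_tlift => c d; rewrite scalerA.
- move=> h; rewrite -(conv_u_ub hR hg) /conv /twist_antipode sw_scale.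
  under eq_tlift => h1 h2.
    rewrite -sw_assoc // (lin_tlift_out (g := twist_mul R ga gb h1)) //.
    under eq_tlift => a h'.
      rewrite (lin_tlift_out (g := twist_mul R ga gb h1)) //.
      under eq_tlift => b c.
        rewrite (linZ (f := twist_mul R ga gb h1)) //.
        over.
      over.
    over.
  rewrite -sw_assoc //; apply: eq_tlift => k c.
  rewrite mulrC -scalerA -twist_mul_antipode_r scale_sw.
  apply: eq_tlift => b z; rewrite scale_sw.
  by apply: eq_tlift => a d; rewrite scalerA mulrC.
Qed.

End TwistIsHopf.

(** * The twisted comodule algebra *)

Section TwistComoduleAlgebra.
Variables (K : fieldType) (H : coalgType K) (R : hopfOps H).
Variables (A : comodType H) (P : algOps A) (ga gb : {scalar (tensor H H)}).
Hypotheses (hR : is_hopf R) (hg : is_cocycle R ga gb).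
Hypothesis (hA : is_comodule_algebra R P).

Local Notation HH := (tensor_coalg H H).
Local Notation "x ∙ y" := (amul R x y) (at level 40, left associativity).
Local Notation S := (antipode R).
Local Notation u := (twist_u R ga).
Local Notation P' := (twist_comodalg gb P).
Local Notation R' := (twist_hopf R ga gb).

Let algP := comodalg_is_algebra hA.
Let bR : bilinear_map (amul R) := amul_bilinear (hopf_is_algebra hR).
Let bP : bilinear_map (amul P) := amul_bilinear algP.
Let lR : lin (mlt R) := mlt_lin (hopf_is_algebra hR).
Let lP : lin (mlt P) := mlt_lin algP.
Let lS : lin S := antipode_linear hR.
Let lga : @lin K HH (Sc K) ga. Proof. exact: linearP. Qed.
Let lgb : @lin K HH (Sc K) gb. Proof. exact: linearP. Qed.
Let lu := twist_u_lin ga hR.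
Let lmR := mulR_lin gb hR.
Let lmT := mulT_lin ga gb hR.

Definition mulA : tensor A A -> A := convr (mlt P) gb.

Lemma mulA_lin : lin mulA. Proof. exact: convr_lin. Qed.
Let lA := mulA_lin.

Lemma twist_comodalg_mulE a b : amul P' a b = mulA (a ⊗ b).
Proof.
rewrite /mulA /convr coact_pure //=.
by do 2!apply: eq_tlift => ? ?; rewrite (mlt_pure _ _ algP).
Qed.

Lemma twist_comodalg_bilinear : bilinear_map (amul P').
Proof.
have -> : amul P' = fun a b => mulA (a ⊗ b).
  by apply: funext => a; apply: funext => b; apply: twist_comodalg_mulE.
by [].
Qed.

Lemma coact_mulA (W : lmodType K) (F : A -> H -> W) (t : tensor A A) :
  bilinear_map F ->
  \sw_(x, y <- coact (mulA t)) F x y =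
  \sw_(t0, t1 <- coact t) F (mlt P t0) (mulR R gb t1).
Proof. exact: (coact_mltr hR hA). Qed.

Lemma twist_comodalgA : associative (amul P').
Proof.
move=> a b c.
transitivity (\sw_(a0, a1 <- coact a) \sw_(b0, b1 <- coact b)
  \sw_(c0, c1 <- coact c)
    gb (a1 ⊗ mulR R gb (b1 ⊗ c1)) *: amul P a0 (amul P b0 c0)).
  rewrite [amul P' b c]twist_comodalg_mulE /=; apply: eq_tlift => a0 a1.
  rewrite (@coact_mulA _ (fun x y => gb (a1 ⊗ y) *: amul P a0 x)) //.
  rewrite coact_pure //.
  by do 2!apply: eq_tlift => ? ?; rewrite (mlt_pure _ _ algP).
rewrite [amul P' a b]twist_comodalg_mulE [RHS]/=.
rewrite (@coact_mulA _ (fun x y =>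
  \sw_(c0, c1 <- coact c) gb (y ⊗ c1) *: amul P x c0)) // coact_pure //.
do 3!apply: eq_tlift => ? ?; rewrite (mlt_pure _ _ algP) (amulA algP).
by rewrite (cocycle_mulR hR hg).
Qed.

Section Coinvariant.
Variable b : A.
Hypothesis bB : coact b = b ⊗ aone R.

Lemma twist_mul_coinvl a : amul P' b a = amul P b a.
Proof.
rewrite /= bB swE //.
under eq_tlift => x y do rewrite (gb1l hR hg).
by rewrite (sw_coact_counit (F := amul P b)).
Qed.

Lemma twist_mul_coinvr a : amul P' a b = amul P a b.
Proof.
rewrite /=.
under eq_tlift => x y do rewrite bB swE // (gb1r hR hg).
by rewrite (sw_coact_counit (F := fun a => amul P a b)).
Qed.

End Coinvariant.

Lemma twist_is_comodule_algebra : is_comodule_algebra R' P'.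
Proof.
split.
- split; [exact: twist_comodalg_bilinear | exact: twist_comodalgA | |].
  + by move=> a; rewrite twist_mul_coinvl ?(coact_one hA) // (amul1l algP).
  + by move=> a; rewrite twist_mul_coinvr ?(coact_one hA) // (amul1r algP).
- exact: coact_one hA.
move=> a b.
rewrite twist_comodalg_mulE -[LHS]sw_pure coact_mulA //.
rewrite -(convl_gb_mulT hR hg).
rewrite -[LHS](@convr_balance K HH _ _ _ _ (mlt P) (mulT R ga gb)) //.
rewrite coact_pure // /tmul.
apply: eq_tlift => x1 x2; apply: eq_tlift => y1 y2.
by rewrite twist_comodalg_mulE /= (twist_mulE _ _ hR).
Qed.

(** The two maps by which the canonical maps of [A] and [A_γ] differ. *)
Definition shear (f : HH -> K) (t : tensor A H) : tensor A H :=
  \sw_(x, h <- t) \sw_(x0, x1 <- coact x) \sw_(h1, h2 <- comul h)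
    f (x1 ⊗ S h1) *: (x0 ⊗ h2).

Definition rescale (v : H -> K) (t : tensor A H) : tensor A H :=
  \sw_(x, h <- t) \sw_(h1, h2 <- comul h) v h1 *: (x ⊗ h2).

Lemma shear_lin (f : HH -> K) : linK f -> lin (shear f).
Proof. by move=> lf; rewrite /shear. Qed.

Lemma rescale_lin (v : H -> K) : linK v -> lin (rescale v).
Proof. by move=> lv; rewrite /rescale. Qed.

Lemma shear_pure (f : HH -> K) x h : linK f -> shear f (x ⊗ h) =
  \sw_(x0, x1 <- coact x) \sw_(h1, h2 <- comul h) f (x1 ⊗ S h1) *: (x0 ⊗ h2).
Proof. by move=> lf; rewrite /shear swE. Qed.

Lemma rescale_pure (v : H -> K) x h : linK v ->
  rescale v (x ⊗ h) = \sw_(h1, h2 <- comul h) v h1 *: (x ⊗ h2).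
Proof. by move=> lv; rewrite /rescale swE. Qed.

Lemma rescale_comp (v w : H -> K) t : linK v -> linK w ->
  rescale v (rescale w t) = rescale (conv w v) t.
Proof.
move=> lv lw; have lvw := conv_linK lw lv.
have l1 := rescale_lin lv; have l2 := rescale_lin lw; have l3 := rescale_lin lvw.
move: t; apply: tensor_ext => // x h.
rewrite !rescale_pure // (lin_tlift_out (g := rescale v)) //.
under eq_tlift => h1 h2.
  rewrite (linZ _ _ l1) rescale_pure // scale_sw.
  over.
rewrite -sw_assoc //; apply: eq_tlift => k h3.
by rewrite /conv sw_scale; apply: eq_tlift => h1 h2; rewrite scalerA.
Qed.

Lemma rescale1 t : rescale counit t = t.
Proof.
have lc : linK (counit : H -> K) by [].
have l1 := rescale_lin lc.
move: t; apply: tensor_ext => // x h.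
by rewrite rescale_pure // (sw_counitl (F := pure x)).
Qed.

(** The two functionals meet as [f(x_1 ⊗ S h_2) g(x_2 ⊗ S h_1)], which is [f * g]
at [x_1 ⊗ S h_1] because [S] reverses the coproduct. *)
Lemma shear_comp (f g : HH -> K) t : linK f -> linK g ->
  shear f (shear g t) = shear (conv f g) t.
Proof.
move=> lf lg; have lfg := conv_linK lf lg.
have l1 := shear_lin lf; have l2 := shear_lin lg; have l3 := shear_lin lfg.
move: t; apply: tensor_ext => // x h.
rewrite !shear_pure // (lin_tlift_out (g := shear f)) //.
under eq_tlift => x0 x1.
  rewrite (lin_tlift_out (g := shear f)) //.
  under eq_tlift => h1 h2.
    rewrite (linZ _ _ l1) shear_pure // scale_sw.
    under eq_tlift => x00 x01 do rewrite scale_sw.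
    over.
  rewrite tlift_exch.
  over.
rewrite sw_coact_assoc //; apply: eq_tlift => x0 x1.
under eq_tlift => y1 y2 do rewrite -sw_assoc //.
rewrite tlift_exch; apply: eq_tlift => k h3.
rewrite /conv (@comul_pureK K H H) // sw_scale; apply: eq_tlift => y1 y2.
rewrite (@comul_antipode_sw _ _ _ hR (Sc K)) // sw_scale; apply: eq_tlift => h1 h2.
by rewrite scalerA mulrC.
Qed.

Lemma shear1 t : shear counit t = t.
Proof.
have lc : linK (counit : HH -> K) by [].
have l1 := shear_lin lc.
move: t; apply: tensor_ext => // x h.
rewrite shear_pure //.
under eq_tlift => x0 x1.
  under eq_tlift => h1 h2.
    rewrite counit_pure (counit_antipode hR) mulrC -scalerA.
    over.
  rewrite (sw_counitl (F := fun h : H => counit x1 *: (x0 ⊗ h))) //.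
  over.
by rewrite (sw_coact_counit (F := fun x : A => x ⊗ h)).
Qed.

Lemma shear_bij : bijective (shear ga).
Proof.
exists (shear gb) => t; rewrite shear_comp //.
- by rewrite (conv_gbga hg) shear1.
- by rewrite (conv_gagb hg) shear1.
Qed.

Lemma rescale_bij : bijective (rescale u).
Proof.
have lub := twist_ub_lin gb hR.
exists (rescale (twist_ub R gb)) => t; rewrite rescale_comp //.
- by rewrite (conv_u_ub hR hg) rescale1.
- by rewrite (conv_ub_u hR hg) rescale1.
Qed.

(** The first identity of [cocycle_cancel] at [g ⊗ h_1 ⊗ S h_2]; on its right side
the legs [h_2 S h_3] cancel. *)
Lemma ga_shift g h :
  \sw_(y, z <- comul h) ga ((g ∙ y) ⊗ S z) =
  \sw_(y, z <- comul h) (gb (g ⊗ y) * u z).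
Proof.
rewrite /twist_u; under [RHS]eq_tlift => y z do rewrite mulr_sw.
rewrite -(@sw_assoc _ _ (Sc K)) //=.
under [RHS]eq_tlift => w d do rewrite (cocycle_cancel hR hg _ _ _).1.
rewrite tlift_exch.
under [RHS]eq_tlift => g1 g2.
  rewrite (@collapse_antipoder _ _ _ hR (Sc K)
    (fun y z w => ga ((g1 ∙ y) ⊗ z) * gb (g2 ⊗ w))) //=.
  under eq_tlift => y z do rewrite (gb1r hR hg) mulrC.
  over.
rewrite tlift_exch; apply: eq_tlift => y z.
by rewrite (sw_counitrK (F := fun g : H => ga ((g ∙ y) ⊗ S z))).
Qed.

End TwistComoduleAlgebra.

(** * Transport along equal coinvariants *)

Section BalancedMaps.
Variables (K : fieldType) (U V : lmodType K).
Variables (I : Type) (ra : U -> I -> U) (la : I -> V -> V).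

Lemma btensor_ext (W : lmodType K) (f g : btensor ra la -> W) :
  lin f -> lin g -> (forall u v, f (ten ra la u v) = g (ten ra la u v)) -> f =1 g.
Proof.
move=> lf lg fg; elim/ten_ind=> [u v | x y fx fy |]; first exact: fg.
  by rewrite !linD // fx fy.
by rewrite !lin0.
Qed.

End BalancedMaps.

Section CanonicalMap.
Variables (K : fieldType) (H : coalgType K) (R : hopfOps H).
Variables (A : comodType H) (P : algOps A).
Hypotheses (hR : is_hopf R) (hA : is_comodule_algebra R P).

Let bR : bilinear_map (amul R) := amul_bilinear (hopf_is_algebra hR).
Let bP : bilinear_map (amul P) := amul_bilinear (comodalg_is_algebra hA).

Local Notation chi := (fun a b => \sw_(b0, b1 <- coact b) amul P a b0 ⊗ b1).

Lemma canonical_bilinear : bilinear_map chi.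
Proof. by []. Qed.

Lemma canonical_balanced :
  balanced (@coinv_ract K H R A P) (@coinv_lact K H R A P) chi.
Proof.
move=> a b a' /=; rewrite /coinv_ract /coinv_lact.
have /eqP bB := valP b.
rewrite (coact_mul_sw hA (F := fun b0 b1 => amul P a b0 ⊗ b1)) // bB swE //.
apply: eq_tlift => x y.
by rewrite (amul1l (hopf_is_algebra hR)) (amulA (comodalg_is_algebra hA)).
Qed.

Lemma canonical_map_lin : lin (@canonical_map K H R A P).
Proof. exact: tlift_linear canonical_bilinear canonical_balanced. Qed.

Lemma canonical_map_ten a b :
  canonical_map (ten (@coinv_ract K H R A P) (@coinv_lact K H R A P) a b) =
  \sw_(b0, b1 <- coact b) amul P a b0 ⊗ b1.
Proof. exact: tlift_ten canonical_bilinear canonical_balanced a b. Qed.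

End CanonicalMap.

Section Transport.
Variables (K : fieldType) (H : coalgType K).

Lemma coinv_val_lin (R : hopfOps H) (A : comodType H) :
  lin (val : coinv R A -> A).
Proof. by move=> a x y; rewrite linearP. Qed.

Variables (R R' : hopfOps H) (A : comodType H) (P P' : algOps A).
Hypothesis eR : aone R = aone R'.

(** The type of coinvariants is indexed by the whole Hopf structure although it
depends only on the unit; [coinv_cast] identifies the two copies. *)
Lemma coinv_cast_subproof (b : coinv R A) : val b \in coinv_pred R' A.
Proof. by have := valP b; rewrite !inE eR. Qed.

Definition coinv_cast (b : coinv R A) : coinv R' A := Coinv (coinv_cast_subproof b).

Lemma coinv_cast_lin : lin coinv_cast.
Proof.
move=> a x y; apply: val_inj.
by rewrite [RHS](coinv_val_lin a (coinv_cast x)) -[LHS](coinv_val_lin a x).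
Qed.

Definition cast_section (s : A -> tensor (coinv R A) A) (a : A) :
    tensor (coinv R' A) A := \sw_(b, a' <- s a) coinv_cast b ⊗ a'.

Let lcast := coinv_cast_lin.

Lemma cast_section_lin s : lin s -> lin (cast_section s).
Proof. by move=> ls; rewrite /cast_section. Qed.

HB.instance Definition _ (s : {linear A -> tensor (coinv R A) A}) :=
  GRing.isLinear.Build K A (tensor (coinv R' A) A) _ (cast_section s)
    (cast_section_lin (@linearP _ _ _ _ s)).

Lemma coinv_mul_lin (hR : is_hopf R) (hA : is_comodule_algebra R P) b :
  lin (coinv_mul hR hA b).
Proof.
move=> a x y; apply: val_inj.
rewrite [RHS](coinv_val_lin a (coinv_mul hR hA b x)) /=.
have bP := amul_bilinear (comodalg_is_algebra hA).
exact: (lin_bil2 bP (val b) (@coinv_val_lin R A)).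
Qed.

End Transport.

Section TransportProjective.
Variables (K : fieldType) (H : coalgType K) (R R' : hopfOps H).
Variables (A : comodType H) (P P' : algOps A).
Hypothesis eR : aone R = aone R'.

Hypothesis eP : forall (b : coinv R A) a, amul P (val b) a = amul P' (val b) a.
Hypotheses (hR : is_hopf R) (hA : is_comodule_algebra R P).
Hypotheses (hR' : is_hopf R') (hA' : is_comodule_algebra R' P').

Lemma equivariantly_projective_transport :
  equivariantly_projective hR hA -> equivariantly_projective hR' hA'.
Proof.
have lcast : lin (coinv_cast (A := A) eR) := coinv_cast_lin eR.
have lv' := @coinv_val_lin K H R' A.
have bP' := amul_bilinear (comodalg_is_algebra hA').
have lm b : lin (coinv_mul hR hA b) := coinv_mul_lin hR hA b.
have lm' b : lin (coinv_mul hR' hA' b) := coinv_mul_lin hR' hA' b.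
case=> s [s1 s2 s3]; exists (cast_section eR s); split => [b' a|a|a].
- pose b := coinv_cast (esym eR) b'.
  rewrite -[amul P' _ a](eP b) /= /cast_section [s _](s1 b) !sw_nest //.
  apply: eq_tlift => c a'; rewrite !swE //; congr (_ ⊗ _).
  by apply: val_inj; apply: (eP b (val c)).
  (* the equivariance of [s] is carried over by applying a linear map to it *)
- pose J (t : tensor (tensor (coinv R A) A) H) : tensor (tensor (coinv R' A) A) H :=
    \sw_(q, h <- t) (\sw_(b, a' <- q) coinv_cast eR b ⊗ a') ⊗ h.
  have lJ : lin J by rewrite /J.
  have := congr1 J (s2 a); rewrite !(lin_tlift_out (g := J)) //.
  under eq_tlift => a0 a1 do rewrite /J swE //.
  move=> ->.
  rewrite /= /cast_section sw_nest //; apply: eq_tlift => b a'.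
  rewrite (lin_tlift_out (g := J)) // swE //.
  by apply: eq_tlift => a0 a1; rewrite /J !swE.
- rewrite /= /cast_section sw_nest // -[RHS]s3.
  by apply: eq_tlift => b a'; rewrite swE // -eP.
Qed.

End TransportProjective.

Section TransportGalois.
Variables (K : fieldType) (H : coalgType K) (R R' : hopfOps H).
Variables (A : comodType H) (P P' : algOps A).
Hypothesis eR : aone R = aone R'.
Hypothesis ePl : forall (b : coinv R' A) a, amul P (val b) a = amul P' (val b) a.
Hypothesis ePr : forall (b : coinv R' A) a, amul P a (val b) = amul P' a (val b).

Definition balanced_cast (t : balanced_tensor R P) : balanced_tensor R' P' :=
  tlift (ten (@coinv_ract K H R' A P') (@coinv_lact K H R' A P')) t.

Lemma ten_cast_balanced :
  balanced (@coinv_ract K H R A P) (@coinv_lact K H R A P)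
    (ten (@coinv_ract K H R' A P') (@coinv_lact K H R' A P')).
Proof.
move=> a b a'; rewrite /coinv_ract /coinv_lact.
rewrite -[val b]/(val (coinv_cast eR b)) ePr ePl; exact: ten_balanced.
Qed.

Lemma balanced_cast_lin : lin balanced_cast.
Proof. exact: tlift_linear (ten_bilinear _ _) ten_cast_balanced. Qed.

Lemma balanced_cast_ten a b :
  balanced_cast (ten (@coinv_ract K H R A P) (@coinv_lact K H R A P) a b) =
  ten (@coinv_ract K H R' A P') (@coinv_lact K H R' A P') a b.
Proof. exact: tlift_ten (ten_bilinear _ _) ten_cast_balanced a b. Qed.

End TransportGalois.

(** * Comparison of the canonical maps *)

Section Comparison.
Variables (K : fieldType) (H : coalgType K) (R : hopfOps H).
Variables (A : comodType H) (P : algOps A) (ga gb : {scalar (tensor H H)}).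
Hypotheses (hR : is_hopf R) (hg : is_cocycle R ga gb).
Hypothesis (hA : is_comodule_algebra R P).

Local Notation HH := (tensor_coalg H H).
Local Notation S := (antipode R).
Local Notation u := (twist_u R ga).
Local Notation P' := (twist_comodalg gb P).
Local Notation R' := (twist_hopf R ga gb).
Local Notation hR' := (twist_is_hopf hR hg).
Local Notation hA' := (twist_is_comodule_algebra hR hg hA).

Let bR : bilinear_map (amul R) := amul_bilinear (hopf_is_algebra hR).
Let bP : bilinear_map (amul P) := amul_bilinear (comodalg_is_algebra hA).
Let lS : lin S := antipode_linear hR.
Let lga : @lin K HH (Sc K) ga. Proof. exact: linearP. Qed.
Let lgb : @lin K HH (Sc K) gb. Proof. exact: linearP. Qed.
Let lu := twist_u_lin ga hR.
Let eR : aone R = aone R' := erefl.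
Let eR' : aone R' = aone R := erefl.

Lemma twist_coinvl (b : coinv R' A) a : amul P (val b) a = amul P' (val b) a.
Proof. by rewrite (twist_mul_coinvl hR hg hA) //; apply/eqP: (valP b). Qed.

Lemma twist_coinvr (b : coinv R' A) a : amul P a (val b) = amul P' a (val b).
Proof. by rewrite (twist_mul_coinvr hR hg hA) //; apply/eqP: (valP b). Qed.

Lemma twist_projective :
  equivariantly_projective hR hA <-> equivariantly_projective hR' hA'.
Proof.
split; apply: equivariantly_projective_transport => // b a.
- exact: (twist_coinvl (coinv_cast eR b)).
- by rewrite -twist_coinvl.
Qed.

(** On [a ⊗ b] both sides are sums of multiples of [a_0 b_0 ⊗ b_3], with the
coefficients [γ(a_1 b_1 ⊗ S b_2)] and [γ̄(a_1 ⊗ b_1) u(b_2)], so [ga_shift]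
applies. *)
Lemma canonical_map_twist (t : balanced_tensor R P) :
  shear R ga (canonical_map t) =
  rescale u (canonical_map (balanced_cast R' P' t)).
Proof.
have lG : lin (shear (A := A) R ga) by apply: shear_lin.
have lY : lin (rescale (A := A) u) by apply: rescale_lin.
have lX := canonical_map_lin hR hA.
have lX' := canonical_map_lin hR' hA'.
have lI := balanced_cast_lin eR twist_coinvl twist_coinvr.
move: t; apply: btensor_ext => [| |a b].
- exact: (lin_comp lG lX).
- exact: (lin_comp lY (lin_comp lX' lI)).
rewrite (canonical_map_ten hR hA).
rewrite (balanced_cast_ten eR twist_coinvl twist_coinvr).
rewrite (canonical_map_ten hR' hA').
rewrite (lin_tlift_out (g := shear R ga)) // (lin_tlift_out (g := rescale u)) //.
transitivity (\sw_(a0, a1 <- coact a) \sw_(b0, k <- coact b)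
  \sw_(w, h <- comul k)
    (\sw_(y, z <- comul w) ga ((amul R a1 y) ⊗ S z)) *: (amul P a0 b0 ⊗ h)).
  under eq_tlift => b0 b1.
    rewrite (shear_pure hR) //.
    rewrite (coact_mul_sw hA (F := fun x y =>
      \sw_(h1, h2 <- comul b1) ga (y ⊗ S h1) *: (x ⊗ h2))) //.
    over.
  rewrite [LHS]tlift_exch; apply: eq_tlift => a0 a1.
  rewrite (sw_coact_assoc (F := fun b0 y z =>
    \sw_(h1, h2 <- comul z) ga (amul R a1 y ⊗ S h1) *: (amul P a0 b0 ⊗ h2))) //.
  apply: eq_tlift => b0 k; rewrite -sw_assoc //.
  by apply: eq_tlift => w h; rewrite sw_scale.
transitivity (\sw_(a0, a1 <- coact a) \sw_(b0, k <- coact b)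
  \sw_(w, h <- comul k)
    (\sw_(y, z <- comul w) (gb (a1 ⊗ y) * u z)) *: (amul P a0 b0 ⊗ h)).
  by do 3!apply: eq_tlift => ? ?; rewrite (ga_shift hR hg).
symmetry.
under eq_tlift => b0 b1.
  rewrite rescale_pure //=.
  under eq_tlift => h1 h2.
    rewrite (lin_tlift_out (g := fun x => u h1 *: (x ⊗ h2))) //.
    under eq_tlift => a0 a1.
      rewrite (lin_tlift_out (g := fun x => u h1 *: (x ⊗ h2))) //.
      under eq_tlift => b00 b01 do
        rewrite (linZ (f := fun x => u h1 *: (x ⊗ h2))) //.
      over.
    over.
  rewrite tlift_exch.
  over.
rewrite [LHS]tlift_exch; apply: eq_tlift => a0 a1.
under eq_tlift => b0 b1 do rewrite tlift_exch.
rewrite sw_coact_assoc //; apply: eq_tlift => b0 k.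
rewrite -sw_assoc //; apply: eq_tlift => w h.
by rewrite sw_scale; apply: eq_tlift => y z; rewrite scalerA.
Qed.

Lemma balanced_cast_bij : bijective (balanced_cast (R := R) (P := P) R' P').
Proof.
have lI := balanced_cast_lin eR twist_coinvl twist_coinvr.
have el (b : coinv R A) a : amul P' (val b) a = amul P (val b) a.
  by rewrite (twist_coinvl (coinv_cast eR b)).
have er (b : coinv R A) a : amul P' a (val b) = amul P a (val b).
  by rewrite (twist_coinvr (coinv_cast eR b)).
have lJ := balanced_cast_lin eR' el er.
exists (balanced_cast R P).
  apply: btensor_ext => [|//|a b]; first exact: (lin_comp lJ lI).
  by rewrite (balanced_cast_ten eR twist_coinvl twist_coinvr)
             (balanced_cast_ten eR' el er).
apply: btensor_ext => [|//|a b]; first exact: (lin_comp lI lJ).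
by rewrite (balanced_cast_ten eR' el er)
           (balanced_cast_ten eR twist_coinvl twist_coinvr).
Qed.

Lemma twist_hopf_galois : hopf_galois R P <-> hopf_galois R' P'.
Proof.
have bG : bijective (shear (A := A) R ga)  by apply: shear_bij hg.
have bY : bijective (rescale (A := A) u)  by apply: rescale_bij hg.
have [I' IK I'K] := balanced_cast_bij.
have [G' GK G'K] := bG; have [Y' YK Y'K] := bY.
split=> bX.
- apply: (@eq_bij _ _ (Y' \o (shear R ga \o (@canonical_map K H R A P \o I')))).
    by apply: bij_comp; [exists (rescale u) | do 2!apply: bij_comp => //;
      exists (balanced_cast R' P')].
  by move=> t; rewrite /= canonical_map_twist I'K YK.
- apply: (@eq_bij _ _ (G' \o (rescale u \o
    (@canonical_map K H R' A P' \o balanced_cast R' P')))).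
    apply: bij_comp; first by exists (shear R ga).
    by do 2!apply: bij_comp => //; exists I'.
  by move=> t; rewrite /= -canonical_map_twist GK.
Qed.

End Comparison.

Theorem corollary3p9 (K : fieldType) (H : coalgType K) (R : hopfOps H)
    (A : comodType H) (P : algOps A) (ga gb : {scalar (tensor H H)}) :
  is_hopf R -> bijective (antipode R) ->
  is_comodule_algebra R P ->
  is_cocycle R ga gb ->
  principal R P <-> principal (twist_hopf R ga gb) (twist_comodalg gb P).
Proof.
move=> hR _ hA hg; split=> [] [hR1 [hA1 [gal proj]]].
- exists (twist_is_hopf hR hg), (twist_is_comodule_algebra hR hg hA); split.
    by apply/(twist_hopf_galois hR hg hA).
  apply: (twist_projective hR hg hA).1.
  by rewrite (Prop_irrelevance hR hR1) (Prop_irrelevance hA hA1).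
- exists hR, hA; split; first by apply/(twist_hopf_galois hR hg hA).
  apply: (twist_projective hR hg hA).2.
  by rewrite (Prop_irrelevance (twist_is_hopf hR hg) hR1)
    (Prop_irrelevance (twist_is_comodule_algebra hR hg hA) hA1).
Qed.
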